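(* Let $\Sigma$ be an orientable, complete, non-compact surface embedded in $\mathbb{R}^3$, not totally geodesic, whose second fundamental form goes to zero at infinity. Let $a>0$ be such that $\tilde p(x,t)=p(x)+t\vec N_x$ is an embedding of $\Sigma\times[-a,a]$ into $\mathbb{R}^3$, and let $\Omega=\Sigma\times[-a,a]$ be the quantum layer over $\Sigma$. Let $\sigma_{ess}$ be the infimum of the essential spectrum of the Dirichlet Laplacian of $\Omega$. Then $$\sigma_{ess}\ge\frac{\pi^2}{4a^2}.$$
   Context: All surfaces are smooth. Let $p:\Sigma\to\mathbb{R}^3$ be the embedding and $\vec N$ a unit normal vector field of $\Sigma$. The second fundamental form $B$ goes to zero at infinity if for every $\varepsilon>0$ there is a compact subset of $\Sigma$ outside of which $\|B\|<\varepsilon$. The quantum layer is the manifold with boundary $\Omega=\Sigma\times[-a,a]$ with the Riemannian metric $ds^2_\Omega$ obtained by pulling back the Euclidean metric via $\tilde p$. The Dirichlet Laplacian of $\Omega$ (with the sign convention making it nonnegative) is the self-adjoint (Friedrichs) extension of the Laplacian acting on smooth functions compactly supported in the interior of $\Omega$. The infimum of its essential spectrum is given by $$\sigma_{ess}=\sup_{K}\ \inf_{f}\ \frac{\int_\Omega|\nabla f|^2\,d\Omega}{\int_\Omega f^2\,d\Omega},$$ where $K$ runs over all compact subsets of $\Omega$ and $f$ runs over all nonzero smooth functions with compact support in the interior of $\Omega$ minus $K$. Equivalently, $K$ may be taken to run over sets of the form $K'\times[-a,a]$ with $K'\subset\Sigma$ compact. *)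

(* Defs.v *)
From HB Require Import structures.
From mathcomp Require Import all_boot all_order all_algebra.
From mathcomp Require Import all_classical all_reals all_analysis.

Set Implicit Arguments.
Unset Strict Implicit.
Unset Printing Implicit Defensive.

Import Order.TTheory GRing.Theory Num.Theory.
Import numFieldNormedType.Exports.

Local Open Scope classical_set_scope.
Local Open Scope ring_scope.

(* The spaces R^2 and R^3 are the products R * R and R * R * R; they carry the
   usual topology and Borel sigma-algebra, but the library norm on a product is
   the sup norm, so the Euclidean structure is given explicitly by [dot]. *)

Section Calculus.
Context {R : realType}.

Fixpoint Ck (V W : normedModType R) (k : nat) (U : set V) (f : V -> W) : Prop :=
  match k with
  | 0 => forall x, U x -> {for x, continuous f}
  | k'.+1 => (forall x, U x -> differentiable f x) /\
             (forall v, Ck k' U ('D_v f))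
  end.

Definition smooth_on (V W : normedModType R) (U : set V) (f : V -> W) :=
  forall k, Ck k U f.

Definition dot (x y : R * R * R) : R :=
  x.1.1 * y.1.1 + x.1.2 * y.1.2 + x.2 * y.2.

Definition enorm (x : R * R * R) : R := Num.sqrt (dot x x).

Definition gram (n : nat) (v : 'I_n -> R * R * R) : 'M[R]_n :=
  \matrix_(i, j) dot (v i) (v j).

Definition e2 (i : 'I_2) : R * R := ((i == 0%N :> nat)%:R, (i == 1%N :> nat)%:R).

Definition e3 (i : 'I_3) : R * R * R :=
  ((i == 0%N :> nat)%:R, (i == 1%N :> nat)%:R, (i == 2%N :> nat)%:R).

End Calculus.

Section Surface.
Context {R : realType}.
Implicit Types (S : set (R * R * R)) (U : set (R * R))
  (phi : R * R -> R * R * R) (N : R * R * R -> R * R * R).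

(* [phi] is a regular parametrization, defined on the open set [U], of a
   relatively open part of [S]; the last clause says that [phi] is open as a
   map from [U] to [S], hence a homeomorphism onto its image. *)
Definition chart S U phi : Prop :=
  [/\ open U, smooth_on U phi, set_inj U phi,
      (forall u, U u -> forall w, 'd phi u w = 0 -> w = 0) &
      forall W : set (R * R), open W ->
        exists2 W' : set (R * R * R), open W' &
          phi @` (U `&` W) = S `&` W'].

(* A surface embedded in R^3 is identified with its image [S], the embedding
   [p] being the inclusion. *)
Definition embedded_surface S : Prop :=
  forall x, S x -> exists U phi, chart S U phi /\ (phi @` U) x.

(* An atlas whose changes of coordinates have positive Jacobian: [M] is the
   Jacobian matrix of the change of coordinates from [c] to [d] at [u]. *)
Definition orientable S : Prop :=
  exists A : set (set (R * R) * (R * R -> R * R * R)),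
    [/\ forall c, A c -> chart S c.1 c.2,
        forall x, S x -> exists2 c, A c & (c.2 @` c.1) x &
        forall c d, A c -> A d -> forall u v, c.1 u -> d.1 v ->
          c.2 u = d.2 v ->
          exists2 M : 'M[R]_2, 0 < \det M &
            forall i, 'D_(e2 i) c.2 u = \sum_j M i j *: 'D_(e2 j) d.2 v].

(* Only the values of [N] on [S] matter. *)
Definition unit_normal_field S N : Prop :=
  (forall x, S x -> enorm (N x) = 1) /\
  forall U phi, chart S U phi ->
    smooth_on U (N \o phi) /\
    forall u, U u -> forall w, dot (N (phi u)) ('d phi u w) = 0.

Definition curve_length (c : R -> R * R * R) : \bar R :=
  (\int[lebesgue_measure]_(t in `[0%R, 1%R]%classic) (enorm (derive1 c t))%:E)%E.

(* The intrinsic distance; it is +oo between distinct components. *)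
Definition surface_dist S (x y : R * R * R) : \bar R :=
  ereal_inf [set curve_length c | c in
    [set c : R -> R * R * R |
      [/\ Ck 1 setT c, forall t, 0 <= t <= 1 -> S (c t), c 0 = x & c 1 = y]]].

Definition complete_surface S : Prop :=
  forall x : nat -> R * R * R, (forall n, S (x n)) ->
    (forall e : R, 0 < e -> exists n0 : nat, forall m n : nat,
      (n0 <= m)%N -> (n0 <= n)%N -> (surface_dist S (x m) (x n) < e%:E)%E) ->
    exists2 l, S l & forall e : R, 0 < e -> exists n0 : nat, forall n : nat,
      (n0 <= n)%N -> (surface_dist S (x n) l < e%:E)%E.

Definition first_form phi (u : R * R) : 'M[R]_2 :=
  gram (fun i => 'D_(e2 i) phi u).

Definition second_form N phi (u : R * R) : 'M[R]_2 :=
  \matrix_(i, j) dot ('D_(e2 j) ('D_(e2 i) phi) u) (N (phi u)).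

(* |B|^2 = g^{ij} g^{kl} h_{jk} h_{li}. *)
Definition second_form_norm N phi (u : R * R) : R :=
  let g' := invmx (first_form phi u) in
  let h := second_form N phi u in
  Num.sqrt (\tr (g' *m h *m g' *m h)).

Definition totally_geodesic S N : Prop :=
  forall U phi, chart S U phi -> forall u, U u -> second_form N phi u = 0.

Definition second_form_vanishes_at_infinity S N : Prop :=
  forall e : R, 0 < e ->
    exists K : set (R * R * R), [/\ compact K, K `<=` S &
      forall U phi, chart S U phi ->
        forall u, U u -> ~ K (phi u) -> second_form_norm N phi u < e].

End Surface.

Section Layer.
Context {R : realType}.
Implicit Types (S : set (R * R * R)) (U : set (R * R))
  (phi : R * R -> R * R * R) (N : R * R * R -> R * R * R) (a : R)
  (mu : {measure set (R * R * R * R) -> \bar R})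
  (f : R * R * R * R -> R) (K : set (R * R * R * R)).

Definition layer S a : set (R * R * R * R) :=
  [set q | S q.1 /\ - a <= q.2 <= a].

Definition layer_interior S a : set (R * R * R * R) :=
  [set q | S q.1 /\ - a < q.2 < a].

Definition layer_map N (q : R * R * R * R) : R * R * R := q.1 + q.2 *: N q.1.

(* A chart of the surface induces the chart [layer_chart phi] of the layer;
   its points are z = ((u1, u2), t). *)
Definition layer_chart phi (z : R * R * R) : R * R * R * R := (phi z.1, z.2).

Definition layer_embedding S N a : Prop :=
  [/\ set_inj (layer S a) (layer_map N),
      (forall U phi, chart S U phi ->
        forall z, U z.1 -> - a <= z.2 <= a ->
        forall w, 'd (layer_map N \o layer_chart phi) z w = 0 -> w = 0) &
      forall W : set (R * R * R * R), open W ->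
        exists2 W' : set (R * R * R), open W' &
          layer_map N @` (layer S a `&` W) = (layer_map N @` layer S a) `&` W'].

(* Matrix, in a chart, of the pull-back of the Euclidean metric. *)
Definition layer_metric N phi (z : R * R * R) : 'M[R]_3 :=
  gram (fun i => 'D_(e3 i) (layer_map N \o layer_chart phi) z).

(* [mu] is the Riemannian volume measure of the layer: it has density
   sqrt (det g) with respect to Lebesgue measure in every chart.  This
   determines [mu] on the Borel subsets of the layer. *)
Definition layer_volume S N a mu : Prop :=
  forall U phi, chart S U phi ->
  forall A : set (R * R * R * R), measurable A ->
    A `<=` [set q | (phi @` U) q.1 /\ - a <= q.2 <= a] ->
    mu A = (\int[(lebesgue_measure \x lebesgue_measure) \x lebesgue_measure]_
      (z in [set z : R * R * R |
               [/\ U z.1, (- a <= z.2 <= a)%R & A (layer_chart phi z)]])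
      (Num.sqrt (\det (layer_metric N phi z)))%:E)%E.

(* |grad f|^2 = g^{ij} (d_i f) (d_j f). *)
Definition chart_grad_sq N phi f (z : R * R * R) : R :=
  let df := \row_i 'D_(e3 i) (f \o layer_chart phi) z in
  (df *m invmx (layer_metric N phi z) *m df^T) 0 0.

(* The value at [q] does not depend on the chart around [q]. *)
Definition grad_sq S N f (q : R * R * R * R) : R :=
  xget 0 [set r | exists U phi z,
    [/\ chart S U phi, U z.1, layer_chart phi z = q &
        r = chart_grad_sq N phi f z]].

(* Nonzero smooth functions with compact support in the interior of the layer
   minus [K], extended by 0 outside of the layer. *)
Definition test_function S a K f : Prop :=
  [/\ (forall U phi, chart S U phi ->
        smooth_on [set z : R * R * R | U z.1 /\ - a < z.2 < a]
                  (f \o layer_chart phi)),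
      (exists C : set (R * R * R * R), [/\ compact C,
        C `<=` layer_interior S a `\` K & forall q, f q != 0 -> C q]) &
      exists q, f q != 0].

Definition rayleigh S N a mu f : \bar R :=
  ((\int[mu]_(q in layer S a) (grad_sq S N f q)%:E) /
   (\int[mu]_(q in layer S a) (f q ^+ 2)%:E))%E.

(* Infimum of the essential spectrum of the Dirichlet Laplacian. *)
Definition sigma_ess S N a mu : \bar R :=
  ereal_sup [set ereal_inf [set rayleigh S N a mu f | f in test_function S a K]
            | K in [set K | compact K /\ K `<=` layer S a]].

End Layer.

(* Main.v *)
(** Let [n] be the unit normal in a chart [phi], [g] and [h] the first and second
    fundamental forms, and [H], [K] the trace and determinant of [g^-1 h].  In the
    coordinates [(u, t)] the layer metric is block diagonal with last block [1], so
    [|grad f|^2 >= (df/dt)^2], and its density is [sqrt (det g) * |1 - t H + t^2 K|].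
    Since [h] is symmetric, [|B|^2 = H^2 - 2 K] controls both [H] and [K]; hence
    outside of a large compact [K' x [-a, a]] the density lies between
    [(1 - d) sqrt (det g)] and [(1 + d) sqrt (det g)].  On each fiber [[-a, a]] the
    one-dimensional Dirichlet inequality has constant [(pi / (2 a))^2]; integrating
    it over [u] bounds the Rayleigh quotients supported outside of [K' x [-a, a]]
    below by [(pi / (2 a))^2 (1 - d) / (1 + d)], with [d] arbitrarily small. *)

Require Import Defs.
From HB Require Import structures.
From mathcomp Require Import all_boot all_order all_algebra.
From mathcomp Require Import all_classical all_reals all_analysis.
From mathcomp Require Import measurable_realfun ring lra.
Set Implicit Arguments.
Unset Strict Implicit.
Unset Printing Implicit Defensive.
Import Order.TTheory GRing.Theory Num.Theory.
Import numFieldNormedType.Exports.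
Local Open Scope classical_set_scope.
Local Open Scope ring_scope.

(** The constant comes from [cos (pi t / (2 a))], the ground state of the Dirichlet problem on
    [[-a, a]]: its logarithmic derivative supplies the corrective term that completes the square on
    each fiber. The main obstacle is the passage from fibers to the layer. The measure [mu] is known
    only through charts, one chart at a time, and the surface has no global parametrization. For a
    single test function, however, the support projects to a compact part of the surface, which
    finitely many chart images cover. These are cut into disjoint measurable pieces of the base; the
    cuts leave every fiber whole, so the fiber inequality survives on each piece and the pieces add
    up. A second obstacle is that [grad_sq] picks an arbitrary chart at each point, so its
    measurability is not at hand. It is only ever bounded from below by the square of the derivative
    in [t], a globally defined and measurable function, through a monotonicity of the integral that
    holds for all nonnegative functions. *)

(** * Open sets are measurable in finite products of the real line *)

#[short(type="topMeasurableType")]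
HB.structure Definition TopMeasurable d := {T of Topological T & Measurable d T}.
HB.saturate (Real.sort _).
(** Joins the product topology and the product sigma-algebra in one structure, so that the results
    below iterate up to [R * R * R * R]. *)
HB.instance Definition _ d1 d2 (T1 : topMeasurableType d1)
  (T2 : topMeasurableType d2) := Measurable.on (T1 * T2)%type.

Section borel_base.
Context d (T : topMeasurableType d).

(** Countability makes every open set a countable union of measurable ones, and the property passes
    to binary products. *)
Definition measurable_base (B : nat -> set T) :=
  (forall n, measurable (B n)) /\
  forall x V, nbhs x V -> exists2 n, B n x & B n `<=` V.

Lemma base_open_measurable B : measurable_base B ->
  forall A : set T, open A -> measurable A.
Proof.
move=> [mB hB] A oA.
rewrite (_ : A = \bigcup_(n in [set n | B n `<=` A]) B n); last first.
  apply/seteqP; split=> [x Ax|x [n /= BA Bx]]; last exact: BA.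
  have [n Bx BA] := hB x A (open_nbhs_nbhs (conj oA Ax)).
  by exists n.
exact: bigcup_measurable.
Qed.

End borel_base.

Lemma prod_measurable_base d1 d2 (T1 : topMeasurableType d1)
    (T2 : topMeasurableType d2) :
  (exists B, @measurable_base _ T1 B) -> (exists B, @measurable_base _ T2 B) ->
  exists B, @measurable_base _ (T1 * T2)%type B.
Proof.
move=> [B1 [mB1 hB1]] [B2 [mB2 hB2]].
(* Indices that code no pair get [set0], which is measurable and contains no point. *)
exists (fun n => if (unpickle n : option (nat * nat)) is Some p
  then B1 p.1 `*` B2 p.2 else set0); split.
  move=> n; case: unpickle => [p|]; last exact: measurable0.
  exact: measurableX.
move=> [x y] V [[V1 V2] /= [xV1 yV2] VV].
have [n1 nx nV1] := hB1 _ _ xV1; have [n2 ny nV2] := hB2 _ _ yV2.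
exists (pickle (n1, n2)); rewrite pickleK//=.
by move=> [u v] [/= /nV1 uV /nV2 vV]; apply: VV.
Qed.

Section real_base.
Context {R : realType}.

Lemma real_measurable_base : exists B, @measurable_base _ R B.
Proof.
exists (fun n => if (unpickle n : option (rat * rat)) is Some p
  then `]ratr p.1, ratr p.2[%classic else set0); split.
  by move=> n; case: unpickle.
move=> x V /nbhs_ballP[e /= e0 eV].
have [p] := @rat_in_itvoo R (x - e) x ltac:(lra).
have [q] := @rat_in_itvoo R x (x + e) ltac:(lra).
rewrite !in_itv/= => /andP[xq qe] /andP[ep px].
exists (pickle (p, q)); rewrite pickleK/=.
  by rewrite in_itv/= px xq.
move=> y /=; rewrite in_itv/= => /andP[py yq]; apply: eV.
rewrite /ball/= ltr_norml; lra.
Qed.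

Lemma open_measurable2 (A : set (R * R)) : open A -> measurable A.
Proof.
have hR := real_measurable_base.
have [B hB] := prod_measurable_base hR hR.
exact: (base_open_measurable hB).
Qed.

Lemma open_measurable3 (A : set (R * R * R)) : open A -> measurable A.
Proof.
have hR := real_measurable_base.
have [B hB] := prod_measurable_base (prod_measurable_base hR hR) hR.
exact: (base_open_measurable hB).
Qed.

Lemma open_measurable4 (A : set (R * R * R * R)) : open A -> measurable A.
Proof.
have hR := real_measurable_base.
have [B hB] := prod_measurable_base
  (prod_measurable_base (prod_measurable_base hR hR) hR) hR.
exact: (base_open_measurable hB).
Qed.

End real_base.

Lemma closed_measurable_of_open d (T : topMeasurableType d) :
  (forall A : set T, open A -> measurable A) ->
  forall A : set T, closed A -> measurable A.
Proof. by move=> oT A cA; rewrite -(setCK A); apply/measurableC/oT/closed_openC. Qed.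

(** * Measurability of continuous functions on measurable sets *)

Lemma measurable_fun_open d (T : measurableType d) (R : realType)
    (D : set T) (f : T -> R) : measurable D ->
  (forall V : set R, open V -> measurable (D `&` f @^-1` V)) ->
  measurable_fun D f.
Proof.
move=> mD h; apply: (measurability _ (RGenOInfty.measurableE R)) => _ [_ [x ->] <-].
apply: h; exact: interval_open.
Qed.

Lemma continuous_on_measurable_fun d (T : topMeasurableType d) (R : realType)
    (D : set T) (f : T -> R) : (forall A : set T, open A -> measurable A) ->
  measurable D -> (forall x, D x -> {for x, continuous f}) ->
  measurable_fun D f.
Proof.
move=> oT mD cf; apply: measurable_fun_open => // V oV.
rewrite (_ : _ `&` _ = D `&` (f @^-1` V)^°).
  apply: measurableI => //; apply: oT; exact: open_interior.
apply/seteqP; split=> x [Dx]; last by move=> /interior_subset.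
by move=> Vfx; split=> //; apply: cf => //; exact: open_nbhs_nbhs.
Qed.

Lemma continuous_measurable_fun2 (R : realType) (D : set (R * R)) (f : R * R -> R) :
  measurable D -> (forall x, D x -> {for x, continuous f}) -> measurable_fun D f.
Proof. exact: continuous_on_measurable_fun open_measurable2. Qed.

Lemma continuous_measurable_fun3 (R : realType) (D : set (R * R * R))
    (f : R * R * R -> R) :
  measurable D -> (forall x, D x -> {for x, continuous f}) -> measurable_fun D f.
Proof. exact: continuous_on_measurable_fun open_measurable3. Qed.

Lemma compact_measurable2 (R : realType) (B : set (R * R)) :
  compact B -> measurable B.
Proof.
move=> cB; apply: (closed_measurable_of_open open_measurable2).
by apply: compact_closed => //; exact: norm_hausdorff.
Qed.

Lemma compact_measurable3 (R : realType) (B : set (R * R * R)) :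
  compact B -> measurable B.
Proof.
move=> cB; apply: (closed_measurable_of_open open_measurable3).
by apply: compact_closed => //; exact: norm_hausdorff.
Qed.

Lemma measurable_fun_pair_on d d1 d2 (T : measurableType d) (T1 : measurableType d1)
    (T2 : measurableType d2) (D : set T) (f : T -> T1) (g : T -> T2) :
  measurable D -> measurable_fun D f -> measurable_fun D g ->
  measurable_fun D (fun x => (f x, g x)).
Proof.
move=> mD mf mg; apply: (eq_measurable_fun (fun x => ((f \_ D) x, (g \_ D) x))).
  by move=> x xD; rewrite /patch xD.
apply: measurable_funTS; apply: measurable_fun_pair;
  exact/(measurable_restrictT _ _).1.
Qed.

(* Images of compact sets are closed, so [h] pulls closed sets back to closed
   sets; [F] need not be injective. *)
Lemma compact_image_measurable_fun d (T : topMeasurableType d)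
    (Z : topologicalType) (R : realType) (F : Z -> T) (P : set Z) (h : T -> R) :
  hausdorff_space T ->
  (forall A : set T, open A -> measurable A) ->
  compact P -> {within P, continuous F} -> {within P, continuous (h \o F)} ->
  measurable_fun (F @` P) h.
Proof.
move=> hT oT cP cF ch.
have cl := closed_measurable_of_open oT.
have mFP : measurable (F @` P).
  apply/cl; apply: compact_closed => //; exact: continuous_compact.
have key C : closed C -> measurable (F @` P `&` h @^-1` C).
  move=> cC.
  have [W cW PW] : exists2 W, closed W & P `&` (h \o F) @^-1` C = P `&` W.
    move/continuous_closedP: ch => /(_ _ cC)/closed_subspaceP[W cW WV].
    by exists W => //; rewrite setIC [RHS]setIC WV.
  suff -> : F @` P `&` h @^-1` C = F @` (P `&` W).
    apply/cl; apply: compact_closed => //; apply: continuous_compact; last first.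
      exact: compact_closedI.
    apply: continuous_subspaceW cF; exact: subIsetl.
  rewrite -PW; apply/seteqP; split=> [x [[z Pz <-]] /= Ch|x [z [Pz Cz] <-]].
    by exists z.
  by split=> //; exists z.
apply: measurable_fun_open => // V oV.
rewrite (_ : _ `&` _ = F @` P `\` (F @` P `&` h @^-1` (~` V))).
  by apply: measurableD => //; apply: key; rewrite closedC.
rewrite setDIr setDv set0U; apply/seteqP; split=> x [PFx Vx]; split=> //.
by apply: contrapT => Vx'; apply: Vx.
Qed.

(** * Monotonicity of integrals and integration in a chart *)

(** The integral of a nonnegative function is a supremum over the simple functions below it, and a
    larger function has more of them. This allows integrands such as [grad_sq]. *)
Lemma ge0_le_integral_nonmeasurable d (T : measurableType d) (R : realType)
    (mu : {measure set T -> \bar R}) (D : set T) (f1 f2 : T -> \bar R) :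
  (forall x, D x -> (0 <= f1 x)%E) -> (forall x, D x -> (f1 x <= f2 x)%E) ->
  (\int[mu]_(x in D) f1 x <= \int[mu]_(x in D) f2 x)%E.
Proof.
move=> f10 f12.
have f20 x : D x -> (0 <= f2 x)%E by move=> Dx; exact: le_trans (f10 _ Dx) (f12 _ Dx).
rewrite !ge0_integralE//; apply: le_ereal_sup => _ [h /= hf <-]; exists h => //= x.
apply: le_trans (hf x) _; exact: lee_restrict.
Qed.

Lemma ge0_le_integral_subset d (T : measurableType d) (R : realType)
    (mu : {measure set T -> \bar R}) (A B : set T) (f1 f2 : T -> \bar R) :
  A `<=` B -> (forall x, A x -> (0 <= f1 x)%E) ->
  (forall x, A x -> (f1 x <= f2 x)%E) -> (forall x, B x -> (0 <= f2 x)%E) ->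
  (\int[mu]_(x in A) f1 x <= \int[mu]_(x in B) f2 x)%E.
Proof.
move=> AB f10 f12 f20; rewrite integral_mkcond [leRHS]integral_mkcond.
apply: ge0_le_integral_nonmeasurable => x _; first exact: erestrict_ge0.
rewrite /patch; have [/set_mem Ax|nA] := boolP (x \in A).
  by rewrite ifT ?f12// inE; exact: AB.
by case: ifPn => // /set_mem; exact: f20.
Qed.

Section integral_chart.
Local Open Scope ereal_scope.
Context d1 d2 (X : measurableType d1) (Y : measurableType d2) (R : realType).
Variables (m : {measure set X -> \bar R}) (mu : {measure set Y -> \bar R}).
Variables (phi : X -> Y) (w : X -> R) (D : set X) (E : set Y).
Hypotheses (mD : measurable D) (mE : measurable E).
Hypotheses (mphi : measurable_fun D phi) (mw : measurable_fun D w).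
Hypothesis w0 : forall x, D x -> (0 <= w x)%R.
Hypothesis DE : forall x, D x -> E (phi x).
Hypothesis muE : forall A, measurable A -> A `<=` E ->
  mu A = \int[m]_(x in D `&` phi @^-1` A) (w x)%:E.

Import HBNNSimple.

Let integral_chart_nnsfun (g : {nnsfun Y >-> R}) :
  \int[mu]_(y in E) (g y)%:E = \int[m]_(x in D) ((g (phi x))%:E * (w x)%:E).
Proof.
have mwE : measurable_fun D (EFin \o w) by exact/measurable_EFinP.
have mg k : measurable (g @^-1` [set k]) by exact: measurable_sfunP.
have mi k : measurable_fun D (\1_(g @^-1` [set k]) \o phi : X -> R).
  by apply: measurableT_comp => //; exact: measurable_indic.
have mk k : measurable_fun D (fun x => (k * \1_(g @^-1` [set k]) (phi x))%:E).
  by apply/measurable_EFinP/measurable_funM => //; exact: mi.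
transitivity (\sum_(k \in range g) k%:E * mu (E `&` g @^-1` [set k])).
  under eq_integral do rewrite fimfunE -fsumEFin//.
  rewrite ge0_integral_fsum//; last 2 first.
  - by move=> y; exact/measurable_EFinP/measurable_funM.
  - by move=> y x _; rewrite nnfun_muleindic_ge0.
  apply: eq_fsbigr => r _; rewrite integralZl_indic_nnsfun// integral_indic//=.
  by rewrite setIC.
transitivity (\sum_(k \in range g)
    \int[m]_(x in D) ((k * \1_(g @^-1` [set k]) (phi x))%:E * (w x)%:E)); last first.
  rewrite -ge0_integral_fsum//; last 2 first.
  - by move=> k; apply: emeasurable_funM.
  - move=> k x Dx; apply: mule_ge0; first by rewrite nnfun_muleindic_ge0.
    by rewrite lee_fin w0.
  apply: eq_integral => x /set_mem Dx.
  by rewrite fimfunE -fsumEFin// ge0_mule_fsuml// => k; rewrite nnfun_muleindic_ge0.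
apply: eq_fsbigr => k /set_mem[y _ <-{k}].
set k := g y.
have k0 : (0 <= k)%R by exact: fun_ge0.
rewrite muE; [|exact: measurableI|exact: subIsetl].
rewrite [RHS](eq_integral (fun x => k%:E * ((w x)%:E * (\1_(g @^-1` [set k]) (phi x))%:E)));
  last by move=> x _; rewrite EFinM -muleA; congr (_ * _); rewrite muleC.
rewrite ge0_integralZl//; last 2 first.
- by apply: emeasurable_funM => //; apply/measurable_EFinP; exact: mi.
- move=> x Dx; apply: mule_ge0; rewrite lee_fin ?w0//.
congr (_ * _); rewrite integral_mkcondr; apply: eq_integral => x /set_mem Dx.
rewrite /patch indicE.
have [xk|xk] := boolP (phi x \in g @^-1` [set k]); last first.
  rewrite mule0 ifF//; apply/negbTE/negP => /set_mem/= -[_ gk].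
  by move/negP: xk; apply; rewrite inE.
by rewrite mule1 ifT// inE; split; [exact: DE|exact: set_mem xk].
Qed.

(** The hypothesis [muE] gives [mu] on sets only. Linearity carries the formula to simple functions,
    and monotone convergence along [nnsfun_approx] to [h]. *)
Lemma ge0_integral_chart (h : Y -> \bar R) : measurable_fun E h ->
  (forall y, E y -> 0 <= h y) ->
  \int[mu]_(y in E) h y = \int[m]_(x in D) (h (phi x) * (w x)%:E).
Proof.
move=> mh h0; pose h_ := nnsfun_approx mE mh.
have mwE : measurable_fun D (EFin \o w) by exact/measurable_EFinP.
have hcvg y : E y -> EFin \o h_^~ y @ \oo --> h y.
  by move=> Ey; apply: cvg_nnsfun_approx.
transitivity (limn (fun n => \int[mu]_(y in E) (h_ n y)%:E)).
  rewrite -monotone_convergence//.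
  - by apply: eq_integral => y /set_mem yE; apply/esym/cvg_lim => //; exact: hcvg.
  - by move=> n; exact/measurable_EFinP/measurable_funP.
  - by move=> n y _; rewrite lee_fin.
  - by move=> y _ i j ij; rewrite lee_fin; exact/lefP/nd_nnsfun_approx.
under eq_fun do rewrite integral_chart_nnsfun.
rewrite -monotone_convergence//.
- apply: eq_integral => x /set_mem Dx; apply/cvg_lim => //.
  apply: cvgeZr => //; exact: hcvg (DE Dx).
- move=> n; apply: emeasurable_funM => //; apply/measurable_EFinP.
  by have : measurable_fun D (h_ n \o phi) by apply: measurableT_comp.
- by move=> n x Dx; rewrite mule_ge0// lee_fin// w0.
- move=> x Dx i j ij; rewrite lee_wpmul2r// lee_fin ?w0//.
  exact/lefP/nd_nnsfun_approx.
Qed.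

End integral_chart.

(** * The one-dimensional Dirichlet inequality *)

Lemma integral_subset_support d (T : measurableType d) (R : realType)
    (mu : {measure set T -> \bar R}) (A B : set T) (f : T -> \bar R) :
  A `<=` B -> (forall x, B x -> ~ A x -> f x = 0%E) ->
  (\int[mu]_(x in B) f x = \int[mu]_(x in A) f x)%E.
Proof.
move=> AB f0; rewrite integral_mkcond [RHS]integral_mkcond.
apply: eq_integral => x _; rewrite /patch.
have [Ax|Ax] := boolP (x \in A).
  by rewrite ifT// inE; exact/AB/set_mem.
case: ifPn => // /set_mem Bx; apply: f0 => // Ax'.
by move/negP: Ax; apply; rewrite inE.
Qed.

(* With [k = pi / (2 a)], [k tan (k t) f^2] vanishes at [b] and [- b], and
   [f'^2 - k^2 f^2 = (f' + k tan (k t) f)^2 - (k tan (k t) f^2)']. *)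
Lemma dirichlet_poincare (R : realType) (a b : R) (f df : R -> R) :
  0 < b < a ->
  (forall t, - a < t < a -> is_derive t 1 f (df t)) ->
  (forall t, - a < t < a -> {for t, continuous df}) ->
  (forall t, b <= `|t| -> f t = 0) ->
  (((pi / (2 * a)) ^+ 2)%:E * \int[lebesgue_measure]_(t in `[(- a)%R, a]) (f t ^+ 2)%:E
   <= \int[lebesgue_measure]_(t in `[(- a)%R, a]) (df t ^+ 2)%:E)%E.
Proof.
move=> /andP[b0 ba] fdf cdf f0; set k := pi / _.
have a0 : 0 < a by exact: lt_trans ba.
have cf t : - a < t < a -> {for t, continuous f}.
  by move=> /fdf[df1 _]; apply/differentiable_continuous/derivable1_diffP.
have inb t : (t \in `[(- b), b]) -> - a < t < a.
  by rewrite in_itv/= => /andP[bt tb]; apply/andP; split; lra.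
have k0 : 0 < k by rewrite divr_gt0 ?pi_gt0// mulr_gt0.
(* Since [k * a = pi / 2], [tan (k t)] is smooth inside the interval but blows up at its ends. This
   is why the integrals are cut down to [[- b, b]] below. *)
have cosk t : - a < t < a -> cos (k * t) != 0.
  move=> /andP[at_ ta]; rewrite gt_eqF// cos_gt0_pihalf//.
  have -> : pi / 2 = k * a :> R.
    by rewrite /k; field; rewrite gt_eqF.
  by rewrite -mulrN !ltr_pM2l// at_ ta.
pose F t := k * tan (k * t) * f t ^+ 2.
pose g t := k ^+ 2 * (1 + tan (k * t) ^+ 2) * f t ^+ 2
  + k * tan (k * t) * (2 * f t * df t).
have dF t : - a < t < a -> is_derive t 1 F (g t).
  move=> ta; have ct := cosk _ ta; have dft := fdf _ ta.
  have dk : is_derive t (1 : R) (fun s => k * s) k.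
    by apply: is_derive_eq; rewrite /GRing.scale/= !mulr1.
  have dt : is_derive t 1 (fun s => tan (k * s)) (k * (1 + tan (k * t) ^+ 2)).
    rewrite -cos2_tan2// [X in is_derive _ _ _ X]mulrC.
    apply: (@is_derive1_comp R tan (fun s => k * s)).
  apply: is_derive_eq.
  rewrite /GRing.scale/= /g; ring.
have ctan t : - a < t < a -> {for t, continuous (fun s => tan (k * s))}.
  move=> ta; apply: (@continuous_comp _ _ _ (fun s => k * s) tan).
    exact: mulrl_continuous.
  exact/continuous_tan/cosk.
have cg t : - a < t < a -> {for t, continuous g}.
  move=> ta; apply: cvgD; (apply: cvgM; first apply: cvgM).
  - exact: cvg_cst.
  - apply: cvgD; first exact: cvg_cst.
    by apply: cvgM; exact: ctan.
  - by apply: cvgM; exact: cf.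
  - exact: cvg_cst.
  - exact: ctan.
  - apply: cvgM; last exact: cdf.
    by apply: cvgM; [exact: cvg_cst|exact: cf].
have within_b (h : R -> R) : (forall t, - a < t < a -> {for t, continuous h}) ->
    {within `[- b, b], continuous h}.
  move=> ch; apply: continuous_in_subspaceT => t /set_mem/=.
  by move=> tb; exact/ch/inb.
have integ (h : R -> R) : (forall t, - a < t < a -> {for t, continuous h}) ->
    lebesgue_measure.-integrable `[- b, b] (EFin \o h).
  move=> ch; apply: continuous_compact_integrable; first exact: segment_compact.
  exact: within_b.
have intg : (\int[lebesgue_measure]_(t in `[(- b)%R, b]) (g t)%:E = 0)%E.
  rewrite (@continuous_FTC2 _ g F)//; last 4 first.
  - by rewrite gtrN.
  - exact: within_b.
  - have cF t : - a < t < a -> {for t, continuous F}.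
      by move=> /dF[dF1 _]; apply/differentiable_continuous/derivable1_diffP.
    split.
    + move=> t tb; have [] // := dF t _.
      by apply: inb; move: tb; apply: subset_itv; rewrite bnd_simp.
    + apply: cvg_at_right_filter; apply: cF; apply: inb; rewrite in_itv/=; lra.
    + apply: cvg_at_left_filter; apply: cF; apply: inb; rewrite in_itv/=; lra.
  - move=> t tb; rewrite derive1E.
    have [|_ ->//] := dF t.
    by apply: inb; move: tb; apply: subset_itv; rewrite bnd_simp.
  by rewrite /F !f0 ?expr0n ?mulr0 ?subee// ?normrN ler_norm.
have cf2 t : - a < t < a -> {for t, continuous (fun t => f t ^+ 2)}.
  by move=> ta; apply: cvgM; exact: cf.
have cdf2 t : - a < t < a -> {for t, continuous (fun t => df t ^+ 2)}.
  by move=> ta; apply: cvgM; exact: cdf.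
have ba' : `[- b, b] `<=` (`[- a, a] : set R).
  by apply: subset_itv; rewrite bnd_simp; lra.
have -> : (\int[lebesgue_measure]_(t in `[(- a)%R, a]) (f t ^+ 2)%:E =
    \int[lebesgue_measure]_(t in `[(- b)%R, b]) (f t ^+ 2)%:E)%E.
  apply: integral_subset_support => // t _ /negP.
  by rewrite in_itv/= -ler_norml -ltNge => /ltW/f0 ->; rewrite expr0n.
apply: (@le_trans _ _ (\int[lebesgue_measure]_(t in `[(- b)%R, b]) (df t ^+ 2)%:E))%E;
  last first.
  rewrite integral_mkcond [leRHS]integral_mkcond.
  apply: ge0_le_integral_nonmeasurable => t _.
    by apply: erestrict_ge0 => s _; rewrite lee_fin sqr_ge0.
  by apply: restrict_lee => // s _; rewrite lee_fin sqr_ge0.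
rewrite -ge0_integralZl_EFin//; last 3 first.
- by move=> t _; rewrite lee_fin sqr_ge0.
- exact: (measurable_int _ (integ _ cf2)).
- exact: sqr_ge0.
(* Adding the vanishing integral of [g] to the right turns the claim into a pointwise inequality,
   whose defect is a square. *)
rewrite -[leRHS]adde0 -intg -integralD//; last 2 first.
- exact: integ.
- exact: integ.
apply: le_integral => //.
- apply: (integ (fun t => k ^+ 2 * f t ^+ 2)) => t ta.
  by apply: cvgM; [exact: cvg_cst|exact: cf2].
- apply: (integ (fun t => df t ^+ 2 + g t)) => t ta.
  by apply: cvgD; [exact: cdf2|exact: cg].
move=> t _; rewrite lee_fin -subr_ge0.
rewrite (_ : _ - _ = (df t + k * tan (k * t) * f t) ^+ 2) ?sqr_ge0//.
rewrite /g; ring.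
Qed.

(** * Directional derivatives and the symmetry of second derivatives *)

Section directional_derivatives.
Context {R : realType} {V W : normedModType R}.
Implicit Types (f g : V -> W) (x v : V) (l : W).

Lemma is_derive_cvg f x v l :
  (fun h : R => h^-1 *: ((f \o shift x) (h *: v) - f x)) @ 0^' --> l ->
  is_derive x v f l.
Proof.
by move=> fl; split; [apply/cvg_ex; exists l|exact: cvg_lim].
Qed.

Lemma derivable_cvg f x v : derivable f x v ->
  (fun h : R => h^-1 *: ((f \o shift x) (h *: v) - f x)) @ 0^' --> 'D_v f x.
Proof. by []. Qed.

End directional_derivatives.

Lemma is_derive_line {R : realType} {V W : normedModType R} (f : V -> W) (x v : V) (s : R) : derivable f (x + s *: v) v ->
  is_derive s 1 (fun s => f (x + s *: v)) ('D_v f (x + s *: v)).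
Proof.
move=> df; apply: is_derive_cvg; have := derivable_cvg df.
apply: cvg_trans; apply: near_eq_cvg; apply: nearW => h /=.
congr (_ *: (f _ - _)).
by rewrite (_ : h%:A = h) ?scalerDl 1?addrCA// /GRing.scale/= mulr1.
Qed.

(** Here [m] stands for a mixed second difference with step [h]: two candidates for the limit of
    [m / h^2] that are both [e / 2]-close to it are [e]-close to each other. *)
Lemma approx_quotient_close (R : realFieldType) (A B m h e : R) : 0 < h ->
  `|m - h ^+ 2 * A| <= h ^+ 2 * (e / 2) ->
  `|m - h ^+ 2 * B| <= h ^+ 2 * (e / 2) -> `|A - B| <= e.
Proof.
move=> h0 k1 k2; have hh0 : 0 < h ^+ 2 by rewrite exprn_gt0.
have : `|(m - h ^+ 2 * B) - (m - h ^+ 2 * A)| <= h ^+ 2 * e.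
  by apply: le_trans (ler_normB _ _) _; rewrite (splitr e) mulrDr lerD.
rewrite (_ : _ - _ = h ^+ 2 * (A - B)); last by ring.
by rewrite normrM gtr0_norm// ler_pM2l.
Qed.

Section schwarz.
Context {R : realType} {V : normedModType R}.
Variables (g : V -> R) (U : set V).
Hypotheses (oU : open U).

Let mixed_difference (v w u : V) (h : R) :=
  g (u + h *: v + h *: w) - g (u + h *: v) - (g (u + h *: w) - g u).

Let mixed_differenceC v w u h :
  mixed_difference v w u h = mixed_difference w v u h.
Proof. by rewrite /mixed_difference [in LHS](addrAC u); ring. Qed.

Let mixed_difference_approx (v w u : V) : U u ->
  (forall x, U x -> derivable g x v) ->
  (forall x, U x -> derivable ('D_v g) x w) ->
  {for u, continuous ('D_w ('D_v g))} ->
  forall e : R, 0 < e -> exists2 d : R, 0 < d & forall h, 0 < h < d ->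
    `|mixed_difference v w u h - h ^+ 2 * 'D_w ('D_v g) u| <= h ^+ 2 * e.
Proof.
move=> Uu dg ddg cg e e0.
have [r /= r0 hr] : exists2 r : R, 0 < r & forall x, `|u - x| < r ->
    U x /\ `|'D_w ('D_v g) u - 'D_w ('D_v g) x| < e.
  have : \forall x \near u, U x /\ `|'D_w ('D_v g) u - 'D_w ('D_v g) x| < e.
    near=> x; split; first by near: x; exact: open_nbhs_nbhs.
    by near: x; move/cvgrPdist_lt: cg; exact.
  by move=> /nbhs_normP[r /= r0 hr]; exists r => // x xr; exact: hr.
(* With [h < r / c] the whole parallelogram lies within [r] of [u]; the [1] keeps [c] positive when
   [v] and [w] vanish. *)
set c := `|v| + `|w| + 1.
have c0 : 0 < c by rewrite ltr_wpDl// addr_ge0.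
exists (r / c); first exact: divr_gt0.
move=> h /andP[h0 hd].
have near_u (s t : R) : 0 <= s <= h -> 0 <= t <= h ->
    U (u + s *: v + t *: w) /\
    `|'D_w ('D_v g) u - 'D_w ('D_v g) (u + s *: v + t *: w)| < e.
  move=> /andP[s0 sh] /andP[t0 th]; apply: hr.
  rewrite -addrA opprD addrA subrr add0r normrN.
  apply: le_lt_trans (ler_normD _ _) _; rewrite !normrZ !ger0_norm//.
  have : s * `|v| + t * `|w| <= h * c.
    rewrite /c !mulrDr mulr1; apply: ler_wpDr; first exact: ltW.
    by apply: lerD; exact: ler_wpM2r.
  move=> /le_lt_trans; apply.
  by rewrite -ltr_pdivlMr.
have hh : 0 <= h <= h by rewrite ltW/=.
have h00 : (0 : R) <= 0 <= h by rewrite lexx ltW.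
pose p s := g (u + h *: w + s *: v) - g (u + s *: v).
have dp s : s \in `]0, h[%R ->
    is_derive s 1 p ('D_v g (u + h *: w + s *: v) - 'D_v g (u + s *: v)).
  rewrite in_itv/= => /andP[s0 sh].
  have sI : 0 <= s <= h by rewrite !ltW.
  apply: is_deriveB; apply: is_derive_line; apply: dg.
    by have [+ _] := near_u s h sI hh; rewrite addrAC.
  by have [+ _] := near_u s 0 sI h00; rewrite scale0r addr0.
have cp : {within `[0, h], continuous p}.
  apply: continuous_in_subspaceT => s /set_mem/=; rewrite in_itv/= => sI.
  apply: cvgB; apply/differentiable_continuous/derivable1_diffP.
    have [|//] := @is_derive_line _ _ _ g (u + h *: w) v s.
    by apply: dg; have [+ _] := near_u s h sI hh; rewrite addrAC.
  have [|//] := @is_derive_line _ _ _ g u v s.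
  by apply: dg; have [+ _] := near_u s 0 sI h00; rewrite scale0r addr0.
have [s sI ps] := MVT h0 dp cp.
have {sI} sI : 0 <= s <= h.
  by move: sI; rewrite in_itv/= => /andP[? ?]; rewrite !ltW.
pose q t := 'D_v g (u + s *: v + t *: w).
have dq (t : R) : 0 <= t <= h ->
    is_derive t 1 q ('D_w ('D_v g) (u + s *: v + t *: w)).
  by move=> tI; apply: is_derive_line; apply: ddg; have [] := near_u s t sI tI.
have dq' t : t \in `]0, h[%R ->
    is_derive t 1 q ('D_w ('D_v g) (u + s *: v + t *: w)).
  by rewrite in_itv/= => /andP[? ?]; apply: dq; rewrite !ltW.
have cq : {within `[0, h], continuous q}.
  apply: continuous_in_subspaceT => t /set_mem/=; rewrite in_itv/= => tI.
  by apply/differentiable_continuous/derivable1_diffP; have [] := dq t tI.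
have [t tI qt] := MVT h0 dq' cq.
have {tI} tI : 0 <= t <= h.
  by move: tI; rewrite in_itv/= => /andP[? ?]; rewrite !ltW.
have [_ close] := near_u s t sI tI.
have -> : mixed_difference v w u h =
    h ^+ 2 * 'D_w ('D_v g) (u + s *: v + t *: w).
  transitivity (p h - p 0).
    rewrite /p /mixed_difference !scale0r !addr0 (addrAC u (h *: w)); ring.
  rewrite ps; move: qt; rewrite /q scale0r addr0 subr0 => qt.
  by rewrite (addrAC u (h *: w)) qt; ring.
rewrite -mulrBr normrM ger0_norm ?sqr_ge0// distrC.
by rewrite ler_wpM2l ?sqr_ge0// ltW.
Unshelve. all: by end_near. Qed.

(** The mixed difference is symmetric in [v] and [w], so both iterated derivatives approximate the
    same quotient. *)
Lemma derive_schwarz (v w u : V) : U u ->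
  (forall x z, U x -> derivable g x z) ->
  (forall x y z, U x -> derivable ('D_y g) x z) ->
  (forall y z, {for u, continuous ('D_z ('D_y g))}) ->
  'D_w ('D_v g) u = 'D_v ('D_w g) u.
Proof.
move=> Uu dg ddg cg.
apply/eqP; rewrite -subr_eq0 -normr_le0; apply/ler_addgt0Pl => e e0.
have e20 : 0 < e / 2 by rewrite divr_gt0.
have [d1 d10 h1] := @mixed_difference_approx v w u Uu (fun x => dg x v)
  (fun x => ddg x v w) (cg v w) _ e20.
have [d2 d20 h2] := @mixed_difference_approx w v u Uu (fun x => dg x w)
  (fun x => ddg x w v) (cg w v) _ e20.
set h := Num.min d1 d2 / 2.
have m0 : 0 < Num.min d1 d2 by rewrite lt_min d10.
have h0 : 0 < h by rewrite divr_gt0.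
have hm : h < Num.min d1 d2 by rewrite ltr_pdivrMr// mulr2n mulrDr mulr1 ltrDl.
have /h1 k1 : 0 < h < d1 by rewrite h0 (lt_le_trans hm)// ge_min lexx.
have /h2 k2 : 0 < h < d2 by rewrite h0 (lt_le_trans hm)// ge_min lexx orbT.
rewrite mixed_differenceC in k1; rewrite addr0.
exact: (approx_quotient_close h0 k1 k2).
Qed.

End schwarz.

(** * Differentiation and continuity of dot products *)

Section dot_derivative.
Context {R : realType} {V : normedModType R}.
Implicit Types (f g : V -> R * R * R) (x v : V).

Lemma is_derive_pair (W1 W2 : normedModType R) (f : V -> W1 * W2) x v :
  derivable f x v ->
  is_derive x v (fun y => (f y).1) ('D_v f x).1 /\
  is_derive x v (fun y => (f y).2) ('D_v f x).2.
Proof.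
move=> /derivable_cvg df; split; apply: is_derive_cvg.
  by apply: (cvg_comp _ (fst : W1 * W2 -> W1) df); exact: cvg_fst.
by apply: (cvg_comp _ (snd : W1 * W2 -> W2) df); exact: cvg_snd.
Qed.

Lemma is_derive_dot f g x v : derivable f x v -> derivable g x v ->
  is_derive x v (fun y => dot (f y) (g y))
    (dot ('D_v f x) (g x) + dot (f x) ('D_v g x)).
Proof.
move=> df dg.
have [[df1 f1E] f2] := is_derive_pair df; have [[dg1 g1E] g2] := is_derive_pair dg.
have [f11 f12] := is_derive_pair df1; have [g11 g12] := is_derive_pair dg1.
rewrite f1E in f11 f12; rewrite g1E in g11 g12.
rewrite /dot; apply: is_derive_eq.
move: ('D_v f x) ('D_v g x) (f x) (g x) => a b c d.
by rewrite /GRing.scale/=; ring.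
Qed.

Lemma continuous_dot (T : topologicalType) (f g : T -> R * R * R) (x : T) :
  {for x, continuous f} -> {for x, continuous g} ->
  {for x, continuous (fun y => dot (f y) (g y))}.
Proof.
have fst_c (A B : topologicalType) (h : T -> A * B) :
    {for x, continuous h} -> {for x, continuous (fun y => (h y).1)}.
  by move=> ch; apply: (continuous_comp ch); exact: cvg_fst.
have snd_c (A B : topologicalType) (h : T -> A * B) :
    {for x, continuous h} -> {for x, continuous (fun y => (h y).2)}.
  by move=> ch; apply: (continuous_comp ch); exact: cvg_snd.
move=> cf cg; apply: cvgD; first apply: cvgD; apply: cvgM.
- exact/fst_c/fst_c.
- exact/fst_c/fst_c.
- exact/snd_c/fst_c.
- exact/snd_c/fst_c.
- exact/snd_c.
- exact/snd_c.
Qed.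

End dot_derivative.

(** * Determinants, Gram matrices and the shape operator in coordinates *)

Local Notation i0 := (@ord0 _).
Local Notation i1 := (lift ord0 (@ord0 _)).
Local Notation i2 := (lift ord0 (lift ord0 (@ord0 _))).

Section small_matrices.
Context {R : realType}.

Lemma det_mx2 (A : 'M[R]_2) :
  \det A = A i0 i0 * A i1 i1 - A i0 i1 * A i1 i0.
Proof.
rewrite (expand_det_row _ ord0) !big_ord_recl big_ord0 /cofactor !det_mx11 !mxE.
have -> : lift i1 (0 : 'I_1) = ord0 :> 'I_2 by exact: val_inj.
have -> : lift ord0 (0 : 'I_1) = i1 :> 'I_2 by exact: val_inj.
rewrite /= /bump/= expr0 expr1; ring.
Qed.

Lemma det_mx3 (A : 'M[R]_3) :
  \det A = A i0 i0 * (A i1 i1 * A i2 i2 - A i1 i2 * A i2 i1)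
         - A i0 i1 * (A i1 i0 * A i2 i2 - A i1 i2 * A i2 i0)
         + A i0 i2 * (A i1 i0 * A i2 i1 - A i1 i1 * A i2 i0).
Proof.
rewrite (expand_det_row _ ord0) !big_ord_recl big_ord0 /cofactor !det_mx2 !mxE.
have -> : lift i1 (ord0 : 'I_2) = ord0 :> 'I_3 by exact: val_inj.
have -> : lift i1 (i1 : 'I_2) = i2 :> 'I_3 by exact: val_inj.
have -> : lift i2 (ord0 : 'I_2) = ord0 :> 'I_3 by exact: val_inj.
have -> : lift i2 (i1 : 'I_2) = i1 :> 'I_3 by exact: val_inj.
rewrite /= /bump/= !addn0 !add0n addn1 expr0 expr1 sqrrN expr1n; ring.
Qed.

(** The scalar triple product, that is, the determinant with rows [p], [q], [r]. *)
Definition det3 (p q r : R * R * R) : R :=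
  p.1.1 * (q.1.2 * r.2 - q.2 * r.1.2)
  - p.1.2 * (q.1.1 * r.2 - q.2 * r.1.1)
  + p.2 * (q.1.1 * r.1.2 - q.1.2 * r.1.1).

Lemma det_gram3 (v : 'I_3 -> R * R * R) :
  \det (gram v) = det3 (v i0) (v i1) (v i2) ^+ 2.
Proof. rewrite det_mx3 !mxE /dot /det3; ring. Qed.

(** The product rule for determinants, applied to one matrix of rows and the transpose of
    another. *)
Lemma det3_mul (p q r a b c : R * R * R) :
  det3 p q r * det3 a b c =
    dot p a * (dot q b * dot r c - dot q c * dot r b)
  - dot p b * (dot q a * dot r c - dot q c * dot r a)
  + dot p c * (dot q a * dot r b - dot q b * dot r a).
Proof. rewrite /dot /det3; ring. Qed.

Lemma dotC (p q : R * R * R) : dot p q = dot q p.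
Proof. rewrite /dot; ring. Qed.

Lemma dot_ge0 (p : R * R * R) : 0 <= dot p p.
Proof. by rewrite /dot !addr_ge0// -expr2 sqr_ge0. Qed.

Lemma dot_eq0 (p : R * R * R) : dot p p = 0 -> p = 0.
Proof.
case: p => [[x y] z]; rewrite /dot/= => h.
have x0 : x = 0 by apply/eqP; rewrite -sqrf_eq0; apply/eqP; nra.
have y0 : y = 0 by apply/eqP; rewrite -sqrf_eq0; apply/eqP; nra.
have z0 : z = 0 by apply/eqP; rewrite -sqrf_eq0; apply/eqP; nra.
by rewrite x0 y0 z0.
Qed.

(** Lagrange's identity: the defect is the squared length of the cross product. *)
Lemma dot_cauchy_schwarz (p q : R * R * R) :
  dot p q ^+ 2 <= dot p p * dot q q.
Proof.
case: p q => [[x y] z] [[u v] w]; rewrite -subr_ge0 /dot/=.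
rewrite (_ : _ - _ = (x * v - y * u) ^+ 2 + (x * w - z * u) ^+ 2
   + (y * w - z * v) ^+ 2); last by ring.
by rewrite !addr_ge0 ?sqr_ge0.
Qed.

(** The vector [y], whose coefficients in the frame [v] are [df] times the inverse Gram matrix, is
    the gradient. Its squared length is the right-hand side and its component along the unit vector
    [v i2] is [df ord0 i2], so Cauchy-Schwarz concludes. *)
Lemma gram3_inverse_ge (v : 'I_3 -> R * R * R) (df : 'rV[R]_3) :
  gram v \in unitmx -> dot (v i2) (v i2) = 1 ->
  df ord0 i2 ^+ 2 <= (df *m invmx (gram v) *m df^T) ord0 ord0.
Proof.
move=> uG v2; set x := df *m invmx (gram v).
have : df = x *m gram v by rewrite /x mulmxKV.
move: x => x dfE.
pose y := x ord0 i0 *: v i0 + x ord0 i1 *: v i1 + x ord0 i2 *: v i2.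
have -> : (x *m df^T) ord0 ord0 = dot y y.
  rewrite dfE !mxE !big_ord_recl big_ord0 !mxE !big_ord_recl !big_ord0 !mxE /y.
  move: (v i0) (v i1) (v i2) (x ord0 i0) (x ord0 i1) (x ord0 i2) => p q r a b c.
  by rewrite /dot/= /GRing.scale/=; ring.
have -> : df ord0 i2 = dot y (v i2).
  rewrite dfE !mxE !big_ord_recl big_ord0 !mxE /y.
  move: (v i0) (v i1) (v i2) (x ord0 i0) (x ord0 i1) (x ord0 i2) => p q r a b c.
  by rewrite /dot/= /GRing.scale/=; ring.
by rewrite -[leRHS]mulr1 -v2; exact: dot_cauchy_schwarz.
Qed.

Lemma continuous_det3 (T : topologicalType) (A : T -> 'M[R]_3) (x : T) :
  (forall i j, {for x, continuous (fun y => A y i j)}) ->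
  {for x, continuous (fun y => \det (A y))}.
Proof.
move=> cA; rewrite (funext (fun y => det_mx3 (A y))).
by apply: cvgD; first apply: cvgB; apply: cvgM; try exact: cA;
  apply: cvgB; apply: cvgM; exact: cA.
Qed.

(* The [q_i] stand for the derivatives of the unit normal [n].  The product of
   [det3 p1 p2 n] with the determinant below is the determinant of the mixed dot
   products, so the [q_i] need not be expanded in the basis [p1, p2]. *)
Lemma det3_parallel_surface (p1 p2 n q1 q2 : R * R * R) (L M P t : R) :
  dot n n = 1 -> dot n p1 = 0 -> dot n p2 = 0 ->
  dot q1 p1 = - L -> dot q1 p2 = - M -> dot q2 p1 = - M -> dot q2 p2 = - P ->
  let D := dot p1 p1 * dot p2 p2 - dot p1 p2 ^+ 2 in
  D != 0 ->
  det3 (p1 + t *: q1) (p2 + t *: q2) n ^+ 2 =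
  D * (1 - t * ((L * dot p2 p2 - 2 * M * dot p1 p2 + P * dot p1 p1) / D)
         + t ^+ 2 * ((L * P - M ^+ 2) / D)) ^+ 2.
Proof.
move=> nn np1 np2 q11 q12 q21 q22 D D0.
have dotDr p q r : dot p (q + t *: r) = dot p q + t * dot p r.
  by rewrite /dot/= /GRing.scale/=; ring.
have pn1 : dot p1 n = 0 by rewrite dotC.
have pn2 : dot p2 n = 0 by rewrite dotC.
have D2 : det3 p1 p2 n ^+ 2 = D.
  by rewrite expr2 det3_mul nn np1 np2 pn1 pn2 /D (dotC p2 p1); ring.
have PA : det3 p1 p2 n * det3 (p1 + t *: q1) (p2 + t *: q2) n =
    D * (1 - t * ((L * dot p2 p2 - 2 * M * dot p1 p2 + P * dot p1 p1) / D)
         + t ^+ 2 * ((L * P - M ^+ 2) / D)).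
  rewrite det3_mul !dotDr nn pn1 pn2 !(dotC _ q1) !(dotC _ q2) q11 q12 q21 q22.
  rewrite (dotC p2 p1) (mulrDr D) (mulrBr D) mulr1.
  by move: D0; rewrite /D => D0; field.
(* By [D2], multiplying the left side by [D] gives the square of [PA]. *)
apply: (mulfI D0); rewrite -{1}D2 -exprMn PA; ring.
Qed.

Definition mx2 (a b c d : R) : 'M[R]_2 :=
  \matrix_(i, j) if i == ord0 then (if j == ord0 then a else b)
                 else (if j == ord0 then c else d).

Lemma mx2E (A : 'M[R]_2) : A = mx2 (A i0 i0) (A i0 i1) (A i1 i0) (A i1 i1).
Proof.
apply/matrixP => i j; rewrite mxE.
case: (unliftP ord0 i) => [i' ->|->]; case: (unliftP ord0 j) => [j' ->|->] //=;
  by rewrite ?(ord1 i') ?(ord1 j').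
Qed.

Lemma mx2_sym (A : 'I_2 -> 'I_2 -> R) : A i1 i0 = A i0 i1 ->
  \matrix_(i, j) A i j = mx2 (A i0 i0) (A i0 i1) (A i0 i1) (A i1 i1).
Proof. by move=> A01; rewrite [LHS]mx2E !mxE A01. Qed.

Lemma gram2E (v : 'I_2 -> R * R * R) :
  gram v = mx2 (dot (v i0) (v i0)) (dot (v i0) (v i1))
               (dot (v i0) (v i1)) (dot (v i1) (v i1)).
Proof. exact: (mx2_sym (dotC _ _)). Qed.

Lemma det_gram2 (v : 'I_2 -> R * R * R) : \det (gram v) =
  dot (v i0) (v i0) * dot (v i1) (v i1) - dot (v i0) (v i1) ^+ 2.
Proof. by rewrite gram2E det_mx2 !mxE/= expr2. Qed.

Lemma mulmx2 a b c d a' b' c' d' : mx2 a b c d *m mx2 a' b' c' d' =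
  mx2 (a * a' + b * c') (a * b' + b * d') (c * a' + d * c') (c * b' + d * d').
Proof.
by rewrite [LHS]mx2E; congr mx2; rewrite mxE !big_ord_recl big_ord0 !mxE/= addr0.
Qed.

Lemma invmx2 a b c d : a * d - b * c != 0 ->
  invmx (mx2 a b c d) = (a * d - b * c)^-1 *: mx2 d (- b) (- c) a.
Proof.
move=> D0; set B := _ *: _.
have AB : mx2 a b c d *m B = 1%:M.
  rewrite /B -scalemxAr mulmx2 [LHS]mx2E [RHS]mx2E; congr mx2; rewrite !mxE/=;
    by field.
have [uA _] := mulmx1_unit AB.
by rewrite -(mulKmx uA B) AB mulmx1.
Qed.

(** The identity [tr (A^2) = (tr A)^2 - 2 det A] for the shape operator [A = g^-1 h], where
    [E, F, G] and [L, M, P] are the classical coefficients of [g] and [h]. *)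
Lemma mxtrace_shape_sq (E F G L M P : R) : let D := E * G - F ^+ 2 in D != 0 ->
  \tr (invmx (mx2 E F F G) *m mx2 L M M P *m invmx (mx2 E F F G) *m mx2 L M M P)
  = ((L * G - 2 * M * F + P * E) / D) ^+ 2 - 2 * ((L * P - M ^+ 2) / D).
Proof.
move=> D; rewrite /D expr2 => D0; rewrite invmx2//.
rewrite -!scalemxAl -!scalemxAr -!scalemxAl !mulmx2.
by rewrite /mxtrace !big_ord_recl big_ord0 !mxE/=; field.
Qed.

(** This is [(k1 - k2)^2] for the principal curvatures. Instead of diagonalizing, the proof writes
    it as a sum of squares with nonnegative coefficients over [(E D)^2]. *)
Lemma shape_discriminant_ge0 (E F G L M P : R) : let D := E * G - F ^+ 2 in
  0 < E -> 0 < D ->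
  0 <= ((L * G - 2 * M * F + P * E) / D) ^+ 2 - 4 * ((L * P - M ^+ 2) / D).
Proof.
move=> D E0 D0.
rewrite (_ : _ - _ = (4 * D * (E * M - F * L) ^+ 2
  + (E * (E * P - G * L) - 2 * F * (E * M - F * L)) ^+ 2) / (E * D) ^+ 2).
  rewrite divr_ge0 ?sqr_ge0// addr_ge0 ?sqr_ge0// mulr_ge0 ?sqr_ge0//.
  by rewrite mulr_ge0// ltW.
have : E * G - F ^+ 2 != 0 by rewrite gt_eqF.
have : E != 0 by rewrite gt_eqF.
by rewrite /D => E0' D0'; field; rewrite E0' D0'.
Qed.

(** Subtracting the discriminant from twice the bound on [H^2 - 2 K] gives [H^2 <= 2 e^2]; then
    [|K| <= e^2 / 2], from above by the discriminant and from below because [H^2 >= 0]. With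
    [a e <= d / 4], each of [t H] and [t^2 K] is at most [d / 2] in absolute value. *)
Lemma jacobian_pinch (a e d t H K : R) : 0 < a -> 0 < d -> d < 1 -> 0 <= e ->
  a * e <= d / 4 -> `|t| <= a -> H ^+ 2 - 2 * K <= e ^+ 2 ->
  0 <= H ^+ 2 - 4 * K ->
  1 - d <= 1 - t * H + t ^+ 2 * K <= 1 + d.
Proof.
move=> a0 d0 d1 e0 ae ta HK disc.
have H2 : H ^+ 2 <= 2 * e ^+ 2 by lra.
have ae2 : (a * e) ^+ 2 <= (d / 4) ^+ 2.
  by rewrite ler_sqr ?nnegrE ?mulr_ge0 ?divr_ge0// ltW.
have dd : d ^+ 2 <= d by rewrite expr2 ler_piMl ?ltW.
have t2 : t ^+ 2 <= a ^+ 2 by rewrite -(real_normK (num_real t)) ler_sqr// nnegrE ltW.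
have tH : `|t * H| <= d / 2.
  have d20 : 0 <= d / 2 by rewrite divr_ge0// ltW.
  rewrite -ler_sqr ?nnegrE// real_normK ?num_real//.
  rewrite exprMn; apply: (@le_trans _ _ (a ^+ 2 * (2 * e ^+ 2))).
    by rewrite ler_pM ?sqr_ge0.
  rewrite exprMn in ae2; nra.
have tK : `|t ^+ 2 * K| <= d / 2.
  rewrite normrM ger0_norm ?sqr_ge0//.
  apply: (@le_trans _ _ (a ^+ 2 * (e ^+ 2 / 2))).
    by rewrite ler_pM ?sqr_ge0// ler_norml; apply/andP; split; have := sqr_ge0 H; lra.
  rewrite exprMn in ae2; nra.
move: tH tK; rewrite !ler_norml => /andP[? ?] /andP[? ?]; apply/andP; split; lra.
Qed.

End small_matrices.

(** * Continuity and partial derivatives on products *)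

Lemma continuous_comp_fst (X Y Z : topologicalType) (g : X -> Z) (z : X * Y) :
  {for z.1, continuous g} -> {for z, continuous (fun p => g p.1)}.
Proof.
move=> cg; apply: (@continuous_comp _ _ _ (fst : X * Y -> X) g) => //.
exact: cvg_fst.
Qed.

(** The two difference quotients are the same function of the step, so the equality holds with no
    differentiability assumption. *)
Lemma derive_fst (R : realType) (V1 V2 W : normedModType R)
    (F : V1 * V2 -> W) (z : V1 * V2) (w : V1) :
  'D_(w, 0) F z = 'D_w (fun x => F (x, z.2)) z.1.
Proof.
case: z => x y; rewrite /derive /=; set f1 := (X in lim (X @ _)).
set f2 := (X in _ = lim (X @ _)); suff -> : f1 = f2 by [].
apply/funext => h; rewrite /f1 /f2 /=; congr (_ *: (F _ - _)).
by congr pair; rewrite /= scaler0 add0r.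
Qed.

Lemma derive_snd (R : realType) (V1 V2 W : normedModType R)
    (F : V1 * V2 -> W) (z : V1 * V2) (w : V2) :
  'D_(0, w) F z = 'D_w (fun y => F (z.1, y)) z.2.
Proof.
case: z => x y; rewrite /derive /=; set f1 := (X in lim (X @ _)).
set f2 := (X in _ = lim (X @ _)); suff -> : f1 = f2 by [].
apply/funext => h; rewrite /f1 /f2 /=; congr (_ *: (F _ - _)).
by congr pair; rewrite /= scaler0 add0r.
Qed.

Lemma e3_0 (R : realType) : e3 i0 = (e2 i0, 0) :> R * R * R.
Proof. by []. Qed.
Lemma e3_1 (R : realType) : e3 i1 = (e2 i1, 0) :> R * R * R.
Proof. by []. Qed.
Lemma e3_2 (R : realType) : e3 i2 = (0, 1) :> R * R * R.
Proof. by []. Qed.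

(** * Geometry of the layer in one chart *)

Section chart_geometry.
Context {R : realType}.
Variables (S : set (R * R * R)) (N : R * R * R -> R * R * R).
Variables (U : set (R * R)) (phi : R * R -> R * R * R).
Hypotheses (hc : chart S U phi) (hN : unit_normal_field S N).

Let n := N \o phi.

Lemma chart_open : open U. Proof. by case: hc. Qed.

(** Contained in the openness clause of [chart], applied to the whole plane. *)
Lemma chart_sub u : U u -> S (phi u).
Proof.
move=> Uu; case: hc => _ _ _ _ /(_ _ openT)[W' _ e].
by have : (phi @` (U `&` setT)) (phi u) by [exists u]; rewrite e => -[].
Qed.

Lemma chart_derivable u v : U u -> derivable phi u v.
Proof. by move=> Uu; case: hc => _ /(_ 1%N)[h _] _ _ _; exact/diff_derivable/h. Qed.

Lemma chart_continuous u : U u -> {for u, continuous phi}.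
Proof. by move=> Uu; case: hc => _ /(_ 0%N) h _ _ _; exact: h. Qed.

Lemma chart_continuous_derive u v : U u -> {for u, continuous ('D_v phi)}.
Proof. by move=> Uu; case: hc => _ /(_ 1%N)[_ h] _ _ _; exact: h. Qed.

Lemma chart_derivable2 u v w : U u -> derivable ('D_v phi) u w.
Proof.
by move=> Uu; case: hc => _ /(_ 2%N)[_ /(_ v)[h _]] _ _ _; exact/diff_derivable/h.
Qed.

Lemma chart_continuous_derive2 u v w : U u -> {for u, continuous ('D_w ('D_v phi))}.
Proof.
by move=> Uu; case: hc => _ /(_ 2%N)[_ /(_ v)[_ /(_ w) h]] _ _ _; exact: h.
Qed.

Lemma normal_derivable u v : U u -> derivable n u v.
Proof. by move=> Uu; have [/(_ 1%N)[h _] _] := hN.2 _ _ hc; exact/diff_derivable/h. Qed.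

Lemma normal_continuous u : U u -> {for u, continuous n}.
Proof. by move=> Uu; have [/(_ 0%N) h _] := hN.2 _ _ hc; exact: h. Qed.

Lemma normal_continuous_derive u v : U u -> {for u, continuous ('D_v n)}.
Proof. by move=> Uu; have [/(_ 1%N)[_ h] _] := hN.2 _ _ hc; exact: h. Qed.

Lemma dot_normal_tangent u w : U u -> dot (n u) ('D_w phi u) = 0.
Proof.
move=> Uu; have [_ /(_ u Uu w)] := hN.2 _ _ hc.
by rewrite deriveE//; case: hc => _ /(_ 1%N)[h _] _ _ _; exact: h.
Qed.

Lemma dot_normal_normal u : U u -> dot (n u) (n u) = 1.
Proof.
move=> Uu; have := hN.1 _ (chart_sub Uu); rewrite /enorm => h.
by rewrite -[LHS]sqr_sqrtr ?dot_ge0// h expr1n.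
Qed.

Lemma near_chart u (P : R * R -> Prop) : U u -> (forall x, U x -> P x) ->
  \forall x \near u, P x.
Proof.
by move=> Uu UP; apply: filterS UP _; exact: open_nbhs_nbhs (conj chart_open Uu).
Qed.

(* Weingarten's equation, from differentiating [dot n ('D_w phi) = 0]. *)
Lemma dot_derive_normal u v w : U u ->
  dot ('D_v n u) ('D_w phi u) = - dot ('D_v ('D_w phi) u) (n u).
Proof.
move=> Uu.
have [_ D1] := is_derive_dot (@normal_derivable u v Uu) (@chart_derivable2 u w v Uu).
have D0 : 'D_v (fun x => dot (n x) ('D_w phi x)) u = 0.
  rewrite (@near_eq_derive _ _ _ _ (cst 0)) ?derive_cst//.
  by apply: near_chart => // x Ux; rewrite dot_normal_tangent.
have {D0 D1} e := etrans (esym D1) D0.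
apply: (etrans (eqP _) (congr1 -%R (dotC _ _))).
by rewrite -addr_eq0; apply/eqP; exact: e.
Qed.

(** Pairing with a constant vector [c] reduces the symmetry to the scalar function [g]. Its
    derivatives are given by dot products only on [U], hence the equalities near a point. *)
Lemma chart_schwarz u v w c : U u ->
  dot ('D_w ('D_v phi) u) c = dot ('D_v ('D_w phi) u) c.
Proof.
move=> Uu; pose g x := dot (phi x) c.
have dg x z : U x -> is_derive x z g (dot ('D_z phi x) c).
  move=> Ux; have := is_derive_dot (@chart_derivable x z Ux) (derivable_cst c x z).
  by move=> h; apply: is_derive_eq h _; rewrite derive_cst {2}/dot/= !mulr0 !addr0.
have nDg x z : U x -> \near x, 'D_z g x = dot ('D_z phi x) c.
  by move=> Ux; apply: near_chart => // y Uy; have [] := @dg y z Uy.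
have ddg x y z : U x -> is_derive x z ('D_y g) (dot ('D_z ('D_y phi) x) c).
  move=> Ux.
  have h := is_derive_dot (@chart_derivable2 x y z Ux) (derivable_cst c x z).
  apply: (@near_eq_is_derive _ _ _ (fun x => dot ('D_y phi x) c)).
    by apply: filterS (nDg x y Ux) => ? ->.
  by apply: is_derive_eq h _; rewrite derive_cst {2}/dot/= !mulr0 !addr0.
have [_ Ew] := ddg u v w Uu; have [_ Ev] := ddg u w v Uu.
apply: (etrans (esym Ew)); apply: (etrans _ Ev).
apply: (derive_schwarz chart_open) => //.
- by move=> x z /(@dg _ z)[].
- by move=> x y z /(@ddg _ y z)[].
move=> y z; have [_ E] := ddg u y z Uu; rewrite /prop_for /continuous_at E.
apply: cvg_trans (continuous_dot (@chart_continuous_derive2 u y z Uu) (@cst_continuous _ _ c u)).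
apply: near_eq_cvg; apply: (near_chart Uu) => x Ux.
by have [_ e] := ddg x y z Ux; exact: (esym e).
Qed.

Lemma diff_chart u (x y : R) : U u ->
  'd phi u (x, y) = x *: 'D_(e2 i0) phi u + y *: 'D_(e2 i1) phi u.
Proof.
move=> Uu; have df : differentiable phi u.
  by case: hc => _ /(_ 1%N)[h _] _ _ _; exact: h.
rewrite !deriveE// -!linearZ -linearD; congr ('d phi u _).
apply/eqP; rewrite -pair_eqE; apply/andP; split; apply/eqP;
  by rewrite /= /GRing.scale/= ?mulr1 ?mulr0 ?addr0 ?add0r.
Qed.

Lemma first_form_gt0 u : U u ->
  0 < dot ('D_(e2 i0) phi u) ('D_(e2 i0) phi u) /\
  0 < dot ('D_(e2 i0) phi u) ('D_(e2 i0) phi u) * dot ('D_(e2 i1) phi u) ('D_(e2 i1) phi u)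
      - dot ('D_(e2 i0) phi u) ('D_(e2 i1) phi u) ^+ 2.
Proof.
move=> Uu; have inj : forall x y : R,
    x *: 'D_(e2 i0) phi u + y *: 'D_(e2 i1) phi u = 0 -> x = 0 /\ y = 0.
  move=> x y; rewrite -diff_chart// => h.
  by case: hc => _ _ _ /(_ u Uu _ h)[].
move: ('D_(e2 i0) phi u) ('D_(e2 i1) phi u) inj => p q inj.
split.
  rewrite lt_neqAle dot_ge0 andbT; apply/eqP => /esym/dot_eq0 p0.
  have [] := inj 1 0; first by rewrite p0 scaler0 scale0r addr0.
  by move/eqP; rewrite oner_eq0.
rewrite subr_gt0 lt_neqAle dot_cauchy_schwarz andbT; apply/eqP => e.
(* If the Gram determinant vanished, so would this combination of [p] and [q], since its squared
   length is that determinant times [dot q q]; this contradicts independence. *)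
have : dot (dot q q *: p - dot p q *: q) (dot q q *: p - dot p q *: q) = 0.
  transitivity (dot q q * (dot p p * dot q q - dot p q ^+ 2)).
    by rewrite /dot/= /GRing.scale/=; ring.
  by rewrite -e subrr mulr0.
move=> /dot_eq0 h.
have [] := inj (dot q q) (- dot p q); first by rewrite scaleNr.
move=> /dot_eq0 q0 _; have [] := inj 0 1; first by rewrite q0 scaler0 scale0r addr0.
move=> _; by move/eqP; rewrite oner_eq0.
Qed.

Definition surface_density (u : R * R) := Num.sqrt (\det (first_form phi u)).

Lemma det_first_form u : \det (first_form phi u) =
  dot ('D_(e2 i0) phi u) ('D_(e2 i0) phi u) * dot ('D_(e2 i1) phi u) ('D_(e2 i1) phi u)
      - dot ('D_(e2 i0) phi u) ('D_(e2 i1) phi u) ^+ 2.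
Proof. exact: det_gram2. Qed.

Lemma surface_density_gt0 u : U u -> 0 < surface_density u.
Proof. by move=> /first_form_gt0[_]; rewrite sqrtr_gt0 det_first_form. Qed.

Definition layer_frame (z : R * R * R) (i : 'I_3) :=
  'D_(e3 i) (layer_map N \o layer_chart phi) z.

Lemma layer_frame_tangent z w : U z.1 ->
  'D_(w, 0) (layer_map N \o layer_chart phi) z =
  'D_w phi z.1 + z.2 *: 'D_w n z.1.
Proof.
move=> Uz; rewrite derive_fst.
have -> : (fun x => (layer_map N \o layer_chart phi) (x, z.2)) =
    phi + z.2 *: n by [].
rewrite deriveD; [|exact: chart_derivable|exact/derivableZ/normal_derivable].
by rewrite deriveZ//; exact: normal_derivable.
Qed.

Lemma layer_frame_normal z :
  'D_(0, 1) (layer_map N \o layer_chart phi) z = n z.1.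
Proof.
rewrite derive_snd; have [_ ->//] : is_derive z.2 (1 : R)
  (fun y : R => (layer_map N \o layer_chart phi) (z.1, y)) (n z.1).
apply: is_derive_cvg; apply: cvg_near_cst.
near=> h; rewrite /layer_map /layer_chart /=.
rewrite (_ : h%:A = h :> R); last by rewrite /GRing.scale/= mulr1.
rewrite opprD addrACA subrr add0r -scalerBl addrK scalerA mulVf ?scale1r//.
by near: h; exact: nbhs_dnbhs_neq.
Unshelve. all: by end_near. Qed.

Let p1 u := 'D_(e2 i0) phi u.
Let p2 u := 'D_(e2 i1) phi u.
Let h11 u := dot ('D_(e2 i0) ('D_(e2 i0) phi) u) (n u).
Let h12 u := dot ('D_(e2 i1) ('D_(e2 i0) phi) u) (n u).
Let h22 u := dot ('D_(e2 i1) ('D_(e2 i1) phi) u) (n u).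
Let D u := dot (p1 u) (p1 u) * dot (p2 u) (p2 u) - dot (p1 u) (p2 u) ^+ 2.
Let H u := (h11 u * dot (p2 u) (p2 u) - 2 * h12 u * dot (p1 u) (p2 u)
  + h22 u * dot (p1 u) (p1 u)) / D u.
Let K u := (h11 u * h22 u - h12 u ^+ 2) / D u.

Lemma det_layer_metric z : U z.1 ->
  \det (layer_metric N phi z) =
  D z.1 * (1 - z.2 * H z.1 + z.2 ^+ 2 * K z.1) ^+ 2.
Proof.
move=> Uz; rewrite det_gram3 e3_0 e3_1 e3_2 !layer_frame_tangent// layer_frame_normal.
apply: det3_parallel_surface.
- exact: dot_normal_normal.
- exact: dot_normal_tangent.
- exact: dot_normal_tangent.
- exact: dot_derive_normal.
(* Weingarten's equation yields the derivatives of [phi] in the order opposite to that of [h12];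
   symmetry swaps them. *)
- exact: (etrans (@dot_derive_normal _ _ _ Uz)
    (congr1 -%R (@chart_schwarz _ _ _ _ Uz))).
- exact: dot_derive_normal.
- exact: dot_derive_normal.
- by rewrite gt_eqF//; have [_] := first_form_gt0 Uz.
Qed.

Lemma second_form_normE u : U u ->
  second_form_norm N phi u = Num.sqrt (H u ^+ 2 - 2 * K u).
Proof.
move=> Uu; rewrite /second_form_norm; congr Num.sqrt.
have -> : first_form phi u = mx2 (dot (p1 u) (p1 u)) (dot (p1 u) (p2 u))
    (dot (p1 u) (p2 u)) (dot (p2 u) (p2 u)).
  exact: gram2E.
have -> : second_form N phi u = mx2 (h11 u) (h12 u) (h12 u) (h22 u).
  apply: (mx2_sym (A := fun i j => dot ('D_(e2 j) ('D_(e2 i) phi) u) (n u))).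
  exact: chart_schwarz.
rewrite mxtrace_shape_sq//.
by rewrite gt_eqF//; have [_] := first_form_gt0 Uu.
Qed.

Lemma layer_density_pinch (a e d : R) z : 0 < a -> 0 < d -> d < 1 -> 0 <= e ->
  a * e <= d / 4 -> U z.1 -> `|z.2| <= a -> second_form_norm N phi z.1 < e ->
  (1 - d) * surface_density z.1 <= Num.sqrt (\det (layer_metric N phi z)) <=
  (1 + d) * surface_density z.1.
Proof.
move=> a0 d0 d1 e0 ae Uz za; rewrite second_form_normE// => Be.
have [E0 D0] := first_form_gt0 Uz.
have disc := @shape_discriminant_ge0 R (dot (p1 z.1) (p1 z.1)) (dot (p1 z.1) (p2 z.1))
  (dot (p2 z.1) (p2 z.1)) (h11 z.1) (h12 z.1) (h22 z.1) E0 D0.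
have HK : H z.1 ^+ 2 - 2 * K z.1 <= e ^+ 2.
  rewrite leNgt; apply/negP => h; move: Be; apply/negP; rewrite -leNgt.
  by rewrite -[e]ger0_norm// -sqrtr_sqr ler_wsqrtr// ltW.
have /andP[J1 J2] := jacobian_pinch a0 d0 d1 e0 ae za HK disc.
rewrite det_layer_metric// sqrtrM; last exact: ltW.
(* As [d < 1], the Jacobian is nonnegative and the absolute value disappears. *)
rewrite sqrtr_sqr ger0_norm; last by rewrite (le_trans _ J1)// subr_ge0 ltW.
have -> : surface_density z.1 = Num.sqrt (D z.1).
  by rewrite /surface_density det_first_form.
by rewrite (mulrC (Num.sqrt (D z.1))) !ler_wpM2r ?sqrtr_ge0.
Qed.

Lemma continuous_layer_frame z w : U z.1 ->
  {for z, continuous ('D_(w, 0) (layer_map N \o layer_chart phi))}.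
Proof.
move=> Uz; rewrite /prop_for /continuous_at layer_frame_tangent//.
have : {for z, continuous (fun z : R * R * R => 'D_w phi z.1 + z.2 *: 'D_w n z.1)}.
  apply: cvgD; first exact: (continuous_comp_fst (chart_continuous_derive Uz)).
  apply: cvgZ; first exact: cvg_snd.
  exact: (continuous_comp_fst (normal_continuous_derive Uz)).
apply: cvg_trans; apply: near_eq_cvg.
have : \forall x \near z, U x.1.
  apply: (@cvg_fst _ _ (nbhs z.1) (nbhs z.2)).
  exact: open_nbhs_nbhs (conj chart_open Uz).
by apply: filterS => x Ux; rewrite layer_frame_tangent.
Qed.

Lemma continuous_det_layer_metric z : U z.1 ->
  {for z, continuous (fun z => \det (layer_metric N phi z))}.
Proof.
move=> Uz.
have cf i : {for z, continuous (layer_frame^~ i)}.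
  rewrite /layer_frame.
  case: (unliftP ord0 i) => [j ->|->]; last first.
    rewrite e3_0; exact: continuous_layer_frame.
  case: (unliftP ord0 j) => [k ->|->]; last first.
    rewrite e3_1; exact: continuous_layer_frame.
  rewrite ord1 e3_2.
  have -> : 'D_(0, 1) (layer_map N \o layer_chart phi) = n \o fst.
    by apply/funext => x; rewrite layer_frame_normal.
  exact: (continuous_comp_fst (normal_continuous Uz)).
have cg i j : {for z, continuous (fun z => layer_metric N phi z i j)}.
  have -> : (fun z => layer_metric N phi z i j) =
      (fun z => dot (layer_frame z i) (layer_frame z j)).
    by apply/funext => x; rewrite mxE.
  by apply: continuous_dot; exact: cf.
exact: continuous_det3.
Qed.

Lemma chart_grad_sq_ge (f : R * R * R * R -> R) z : U z.1 ->
  layer_metric N phi z \in unitmx ->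
  ('D_(e3 i2) (f \o layer_chart phi) z) ^+ 2 <= chart_grad_sq N phi f z.
Proof.
move=> Uz uG.
have v2 : dot ('D_(e3 i2) (layer_map N \o layer_chart phi) z)
    ('D_(e3 i2) (layer_map N \o layer_chart phi) z) = 1.
  by rewrite e3_2 layer_frame_normal dot_normal_normal.
have := gram3_inverse_ge (\row_i 'D_(e3 i) (f \o layer_chart phi) z) uG v2.
by rewrite {1}mxE.
Qed.

End chart_geometry.

(** * Iterated integrals and Lebesgue measure in the plane *)

Section tonelli_rectangle.
Local Open Scope ereal_scope.
Context d1 d2 (T1 : measurableType d1) (T2 : measurableType d2) (R : realType).
Variables (m1 : {sigma_finite_measure set T1 -> \bar R})
  (m2 : {sigma_finite_measure set T2 -> \bar R}).
Variables (V : set T1) (I : set T2) (g : T1 * T2 -> \bar R).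
Hypotheses (mV : measurable V) (mI : measurable I).
Hypotheses (mg : measurable_fun (V `*` I) g).
Hypothesis g0 : forall z, (V `*` I) z -> 0 <= g z.

Let mVI : measurable (V `*` I). Proof. exact: measurableX. Qed.

Let mgD : measurable_fun setT (g \_ (V `*` I)).
Proof. exact/(measurable_restrictT _ _).1. Qed.

Let gD0 z : 0 <= (g \_ (V `*` I)) z.
Proof. exact: erestrict_ge0. Qed.

Let section_patch x : V x ->
  \int[m2]_y (g \_ (V `*` I)) (x, y) = \int[m2]_(y in I) g (x, y).
Proof.
move=> Vx; rewrite [RHS]integral_mkcond; apply: eq_integral => y _.
rewrite /patch; have [yI|yI] := boolP (y \in I).
  by rewrite ifT// inE; split=> //; exact: set_mem.
rewrite ifF//; apply/negbTE/negP => /set_mem[_ /= Iy].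
by move/negP: yI; apply; rewrite inE.
Qed.

Lemma tonelli_rectangle :
  \int[m1 \x m2]_(z in V `*` I) g z = \int[m1]_(x in V) \int[m2]_(y in I) g (x, y).
Proof.
rewrite integral_mkcond fubini_tonelli1// /fubini_F [RHS]integral_mkcond.
apply: eq_integral => x _; rewrite [RHS]/patch; case: ifPn => [/set_mem Vx|xV].
  exact: section_patch.
apply: integral0_eq => y _; rewrite /patch ifF//; apply/negbTE/negP.
by move=> /set_mem[/= Vx _]; move/negP: xV; apply; rewrite inE.
Qed.

Lemma measurable_tonelli_rectangle :
  measurable_fun V (fun x => \int[m2]_(y in I) g (x, y)).
Proof.
have h := @measurable_fun_fubini_tonelli_F _ _ T1 T2 R m2 _ mgD gD0.
apply: (eq_measurable_fun (fubini_F m2 (g \_ (V `*` I)))).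
  by move=> x /set_mem Vx; rewrite /fubini_F section_patch.
exact: measurable_funTS.
Qed.

End tonelli_rectangle.

Lemma compact_measure2_finite (R : realType) (B : set (R * R)) : compact B ->
  ((lebesgue_measure \x lebesgue_measure)%E B < +oo)%E.
Proof.
move=> cB.
have c1 : compact (fst @` B).
  apply: continuous_compact => //; apply: continuous_subspaceT => x; exact: cvg_fst.
have c2 : compact (snd @` B).
  apply: continuous_compact => //; apply: continuous_subspaceT => x; exact: cvg_snd.
have m1 := compact_measurable c1; have m2 := compact_measurable c2.
have mB := compact_measurable2 cB.
apply: (@le_lt_trans _ _ ((lebesgue_measure \x lebesgue_measure)%E
    ((fst @` B) `*` (snd @` B)))).
  have sB : B `<=` (fst @` B) `*` (snd @` B).
    by move=> [x y] Bxy; split=> /=; exists (x, y).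
  apply: le_measure; [by rewrite inE|by rewrite inE; exact: measurableX|exact: sB].
have := @product_measure1E _ _ _ _ R (@lebesgue_measure R) (@lebesgue_measure R)
  _ _ m1 m2.
move=> /= ->; apply: lte_mul_pinfty.
- exact: measure_ge0.
- by rewrite ge0_fin_numE ?measure_ge0//; exact: compact_finite_measure.
- exact: compact_finite_measure.
Qed.

Lemma compact_closed_ball2 (R : realType) (u : R * R) (r : R) : 0 < r ->
  compact (closed_ball u r).
Proof.
move=> r0; apply: (@subclosed_compact _ _
    (`[u.1 - r, u.1 + r]%classic `*` `[u.2 - r, u.2 + r]%classic)).
- exact: closed_ball_closed.
- by apply: compact_setX; exact: segment_compact.
rewrite closed_ballE// => -[x y]; rewrite /closed_ball_/= prod_normE/= ge_max.
move=> /andP[]; rewrite !ler_norml => hx hy.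
by split; rewrite /= in_itv/=; lra.
Qed.

Lemma sigma_finite_lebesgue2 (R : realType) :
  sigma_finite setT (@lebesgue_measure R \x @lebesgue_measure R)%E.
Proof.
pose Q n : set (R * R) := `[- n%:R, n%:R]%classic `*` `[- n%:R, n%:R]%classic.
exists Q.
  apply/esym/seteqP; split=> // -[x y] _.
  exists (Num.truncn (Num.max `|x| `|y|)).+1 => //.
  have := truncnS_gt (Num.max `|x| `|y|); rewrite gt_max => /andP[hx hy].
  by split; rewrite /= in_itv/= -ler_norml ltW.
move=> n; have cQ : compact (Q n) by apply: compact_setX; exact: segment_compact.
split; last exact: compact_measure2_finite.
by apply: measurableX; exact: measurable_itv.
Qed.

(* The library's canonical [sigma_finite_measure] structure on product measures
   covers only subprobabilities. *)
Definition lebesgue_measure2 (R : realType) :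
    {sigma_finite_measure set _ -> \bar R} :=
  HB.pack (@lebesgue_measure R \x @lebesgue_measure R)%E
    (Measure_isSigmaFinite.Build _ _ _ _ (@sigma_finite_lebesgue2 R)).

Lemma is_derive_snd (R : realType) (V1 V2 W : normedModType R)
    (F : V1 * V2 -> W) (z : V1 * V2) (w : V2) : derivable F z (0, w) ->
  is_derive z.2 w (fun y => F (z.1, y)) ('D_(0, w) F z).
Proof.
move=> /derivable_cvg dF; apply: is_derive_cvg.
move: dF; case: z => x y /=; apply: cvg_trans; apply: near_eq_cvg.
apply: nearW => h /=; congr (_ *: (F _ - _)).
by congr pair; rewrite /= scaler0 add0r.
Qed.

Lemma continuous_section (X Y Z : topologicalType) (g : X * Y -> Z) x y :
  {for (x, y), continuous g} -> {for y, continuous (fun t => g (x, t))}.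
Proof.
move=> cg A /cg[[P Q] /= [Px Qy] PQ]; apply: filterS Qy => s Qs.
by apply: (PQ (x, s)); split=> //=; exact: nbhs_singleton.
Qed.

Lemma continuous_pair (X Y Z : topologicalType) (f : X -> Y) (g : X -> Z) x :
  {for x, continuous f} -> {for x, continuous g} ->
  {for x, continuous (fun t => (f t, g t))}.
Proof.
move=> cf cg A [[P Q] /= [Pf Qg] PQ].
have h1 : nbhs x (f @^-1` P) := cf _ Pf.
have h2 : nbhs x (g @^-1` Q) := cg _ Qg.
by apply: filterS (filterI h1 h2) => t [Pt Qt]; exact: (PQ (f t, g t)).
Qed.

Lemma near_norm_gt (R : realType) (b t : R) : b < `|t| ->
  \forall s \near t, b < `|s|.
Proof.
move=> bt; have h : (@Num.norm R R) @ t --> `|t| by exact: norm_continuous.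
exact: (h _ (lt_nbhsr bt)).
Qed.

(** * A test function along the fibers of the layer *)

Section layer_function.
Context {R : realType}.
Variables (S : set (R * R * R)) (a b : R) (f : R * R * R * R -> R).
Hypothesis (b0 : 0 < b) (ba : b < a).
Hypothesis hf : forall U phi, chart S U phi ->
  smooth_on [set z : R * R * R | U z.1 /\ - a < z.2 < a] (f \o layer_chart phi).
Hypothesis fb : forall x t, b <= `|t| -> f (x, t) = 0.

(** The coordinate [t] is global, so this derivative needs no chart and can be integrated over
    regions that meet several charts. *)
Definition layer_dt (q : R * R * R * R) : R := 'D_1 (fun t => f (q.1, t)) q.2.

Variables (U : set (R * R)) (phi : R * R -> R * R * R).
Hypothesis hc : chart S U phi.

Lemma layer_dt_chart :
  layer_dt \o layer_chart phi = 'D_(0, 1) (f \o layer_chart phi).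
Proof. by apply/funext => z; rewrite derive_snd. Qed.

Lemma near_outer (z : R * R * R) : b < `|z.2| -> \forall y \near z, (f \o layer_chart phi) y = 0.
Proof.
move=> bz; have : \forall y \near z, b < `|y.2|.
  have h : (snd : R * R * R -> R) @ z --> z.2 by exact: cvg_snd.
  exact: (h _ (near_norm_gt bz)).
by apply: filterS => y /ltW by_; rewrite /= /layer_chart fb.
Qed.

Lemma layer_chart_function_derivable (z : R * R * R) : U z.1 ->
  derivable (f \o layer_chart phi) z (0, 1).
Proof.
move=> Uz; have [bz|zb] := ltP b `|z.2|.
  apply: (@near_eq_derivable _ _ _ (cst 0)); last exact: derivable_cst.
  by apply: filterS (near_outer bz) => y ->.
have [+ _] := hf hc 1%N => /(_ z) h; apply/diff_derivable/h; split=> //.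
by rewrite -ltr_norml (le_lt_trans zb).
Qed.

(** Smoothness is given only for [|t| < a], while the integrals run over the closed interval. Where
    [|t| <= b < a] smoothness applies; where [|t| > b] the function vanishes on a neighborhood. *)
Lemma layer_chart_function_continuous (z : R * R * R) : U z.1 ->
  {for z, continuous (f \o layer_chart phi)} /\
  {for z, continuous (layer_dt \o layer_chart phi)}.
Proof.
move=> Uz; rewrite layer_dt_chart; have [bz|zb] := ltP b `|z.2|; last first.
  have zI : U z.1 /\ - a < z.2 < a.
    by split=> //; rewrite -ltr_norml (le_lt_trans zb).
  have c0 := hf hc 0%N z zI.
  have [_ /(_ (0, 1)) c1] := hf hc 1%N; have {}c1 := c1 z zI.
  by split; [exact: c0|exact: c1].
have cst_c (g : R * R * R -> R) : (\forall y \near z, g y = 0) ->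
    {for z, continuous g}.
  move=> g0; rewrite /prop_for /continuous_at (nbhs_singleton g0).
  exact: cvg_near_cst.
split; first exact/cst_c/near_outer.
apply: cst_c.
(* The derivative must vanish at all points near [z], so [f] has to vanish around each of them. *)
have : \forall y \near z, \forall x \near y, (f \o layer_chart phi) x = 0.
  by apply/near_join; exact: near_outer.
apply: filterS => y fy.
by apply: (etrans (near_eq_derive (g := cst 0) _ fy)); exact: derive_cst.
Qed.

Lemma layer_fiber_poincare u : U u ->
  (((pi / (2 * a)) ^+ 2)%:E *
     \int[lebesgue_measure]_(t in `[(- a)%R, a]) (f (phi u, t) ^+ 2)%:E
   <= \int[lebesgue_measure]_(t in `[(- a)%R, a]) (layer_dt (phi u, t) ^+ 2)%:E)%E.
Proof.
move=> Uu; apply: (@dirichlet_poincare _ a b); first by rewrite b0.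
- move=> t _.
  have := @is_derive_snd _ _ _ _ (f \o layer_chart phi) (u, t) 1
    (@layer_chart_function_derivable (u, t) Uu).
  by rewrite derive_snd.
- move=> t _; have [_ +] := @layer_chart_function_continuous (u, t) Uu.
  by move=> /continuous_section.
- by move=> t; exact: fb.
Qed.

End layer_function.

(** * Integration over the part of the layer above a compact piece of a chart *)

Section chart_box.
Context {R : realType}.
Variables (S : set (R * R * R)) (N : R * R * R -> R * R * R) (a : R).
Variables (mu : {measure set (R * R * R * R) -> \bar R}).
Hypotheses (hN : unit_normal_field S N) (hmu : layer_volume S N a mu).
Variables (U : set (R * R)) (phi : R * R -> R * R * R) (B : set (R * R)).
Hypotheses (hc : chart S U phi) (cB : compact B) (BU : B `<=` U).
Variables (Y : set (R * R * R)).
Hypothesis mY : measurable Y.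

Let w z := Num.sqrt (\det (layer_metric N phi z)).
Let I : set R := `[- a, a]%classic.
Let V := B `&` phi @^-1` Y.

Definition chart_box : set (R * R * R * R) := ((phi @` B) `&` Y) `*` I.

Let mI : measurable I. Proof. exact: measurable_itv. Qed.

Let mB : measurable B.
Proof.
exact: compact_measurable2.
Qed.

Let mphi : measurable_fun B phi.
Proof.
have c1 u : B u -> {for u, continuous (fst \o phi)}.
  move=> /BU Uu; apply: continuous_comp; first exact: chart_continuous hc _ Uu.
  exact: cvg_fst.
have m1 : measurable_fun B (fst \o (fst \o phi)).
  apply: (continuous_measurable_fun2 mB).
  by move=> u Bu; apply: continuous_comp (c1 u Bu) _; exact: cvg_fst.
have m2 : measurable_fun B (snd \o (fst \o phi)).
  apply: (continuous_measurable_fun2 mB).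
  by move=> u Bu; apply: continuous_comp (c1 u Bu) _; exact: cvg_snd.
have m3 : measurable_fun B (snd \o phi).
  apply: (continuous_measurable_fun2 mB).
  move=> u /BU Uu; apply: continuous_comp; first exact: chart_continuous hc _ Uu.
  exact: cvg_snd.
have -> : phi = fun u => ((phi u).1.1, (phi u).1.2, (phi u).2).
  by apply/funext => u; case: (phi u) => [[]].
by apply: (measurable_fun_pair_on mB) => //; exact: (measurable_fun_pair_on mB).
Qed.

Lemma measurable_chart_preimage : measurable V. Proof. exact: mphi. Qed.

Let mV := measurable_chart_preimage.

Let within_phi : {within B, continuous phi}.
Proof.
apply: continuous_in_subspaceT => u /set_mem/BU Uu; exact: chart_continuous hc _ Uu.
Qed.

Lemma measurable_chart_image : measurable (phi @` B).
Proof.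
by apply: compact_measurable3; exact: continuous_compact.
Qed.

Lemma measurable_chart_box : measurable chart_box.
Proof.
apply: measurableX => //; apply: measurableI => //; exact: measurable_chart_image.
Qed.

Let mVI : measurable (V `*` I). Proof. exact: measurableX. Qed.

Let VIU z : (V `*` I) z -> U z.1. Proof. by move=> [[/BU]]. Qed.

Let cw z : U z.1 -> {for z, continuous w}.
Proof.
move=> Uz; have := continuous_det_layer_metric hc hN Uz => h.
apply: (continuous_comp h); exact: sqrt_continuous.
Qed.

Let mw : measurable_fun (V `*` I) w.
Proof.
apply: (continuous_measurable_fun3 mVI).
by move=> z /VIU; exact: cw.
Qed.

Let mlc : measurable_fun (V `*` I) (layer_chart phi).
Proof.
apply: (measurable_fun_pair_on mVI); last exact: measurable_funTS measurable_snd.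
apply: (measurable_comp (F := B)) => //.
  by move=> _ [z [[Bz _] _] <-].
exact: measurable_funTS measurable_fst.
Qed.

Let continuous_layer_chart z : U z.1 -> {for z, continuous (layer_chart phi)}.
Proof.
move=> Uz; have c1 := continuous_comp_fst (Y := R) (chart_continuous hc Uz).
apply: (continuous_pair c1); exact: cvg_snd.
Qed.

Section functions.
Variable h : R * R * R * R -> R.
Hypothesis ch : forall z, U z.1 -> {for z, continuous (h \o layer_chart phi)}.
Hypothesis h0 : forall q, 0 <= h q.

(** Continuity of [h] is known only when read in the chart; it passes to the image because [B * I]
    is compact. *)
Lemma measurable_fun_chart_box : measurable_fun chart_box h.
Proof.
have m : measurable_fun (layer_chart phi @` (B `*` I)) h.
  apply: compact_image_measurable_fun.
  - exact: norm_hausdorff.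
  - exact: open_measurable4.
  - by apply: compact_setX => //; exact: segment_compact.
  - apply: continuous_in_subspaceT => z /set_mem[/BU Uz _].
    exact: continuous_layer_chart.
  - by apply: continuous_in_subspaceT => z /set_mem[/BU Uz _]; exact: ch.
apply: measurable_funS m.
  rewrite (_ : _ @` _ = (phi @` B) `*` I).
    by apply: measurableX => //; exact: measurable_chart_image.
  apply/seteqP; split=> [_ [[u t] [/= Bu It] <-]|[x t] [/= [u Bu <-] It]].
    by split=> //=; exists u.
  by exists (u, t).
by move=> [x t] [/= [[u Bu <-] _] It]; exists (u, t).
Qed.

Let g z := (h (layer_chart phi z) * w z)%:E.

Let g0 z : (0 <= g z)%E. Proof. by rewrite lee_fin mulr_ge0// sqrtr_ge0. Qed.

Let mg : measurable_fun (V `*` I) g.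
Proof.
apply/measurable_EFinP/measurable_funM => //.
apply: (continuous_measurable_fun3 mVI).
by move=> z /VIU; exact: ch.
Qed.

Lemma integral_chart_box :
  (\int[mu]_(q in chart_box) (h q)%:E =
   \int[(lebesgue_measure \x lebesgue_measure) \x lebesgue_measure]_(z in V `*` I)
     g z)%E.
Proof.
rewrite (@ge0_integral_chart _ _ _ _ R
  ((lebesgue_measure \x lebesgue_measure) \x lebesgue_measure)%E mu
  (layer_chart phi) w (V `*` I) chart_box)//.
- exact: measurable_chart_box.
- by move=> z _; exact: sqrtr_ge0.
- by move=> z [[Bz Yz] Iz]; split=> //=; split=> //; exists z.1.
- move=> A mA AE; rewrite (hmu hc mA); last first.
    move=> q /AE[[[u Bu uq] _] Iq]; split; last by move: Iq; rewrite /I/= in_itv.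
    by exists u; [exact: BU|].
  suff -> : [set z : R * R * R | [/\ U z.1, - a <= z.2 <= a & A (layer_chart phi z)]]
      = (V `*` I) `&` layer_chart phi @^-1` A by [].
  apply/seteqP; split=> z /=.
    move=> [Uz Iz Az]; have [/= [[u Bu uz] Yz] _] := AE _ Az.
    (* The definition of [mu] integrates over all of [U]; injectivity of [phi] brings the parameter
       back into [B]. *)
    have inj : set_inj U phi by case: hc.
    have uE : u = z.1 by apply: inj => //; rewrite inE//; exact: BU.
    by rewrite uE in Bu; do 2?split=> //=; rewrite in_itv.
  by move=> [[[Bz Yz] Iz] Az]; split=> //; exact: BU.
- apply/measurable_EFinP; exact: measurable_fun_chart_box.
- by move=> q _; rewrite lee_fin.
Qed.

Lemma integral_chart_box_fibers :
  (\int[mu]_(q in chart_box) (h q)%:E =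
   \int[lebesgue_measure \x lebesgue_measure]_(u in V)
     \int[lebesgue_measure]_(t in I) g (u, t))%E.
Proof.
apply: (etrans integral_chart_box).
exact: (@tonelli_rectangle _ _ _ _ R (lebesgue_measure2 R)
  (@lebesgue_measure R) V I g mV mI mg (fun z _ => g0 z)).
Qed.

Lemma measurable_chart_box_fibers :
  measurable_fun V (fun u => \int[lebesgue_measure]_(t in I) g (u, t))%E.
Proof.
exact: (@measurable_tonelli_rectangle _ _ _ _ R
  (@lebesgue_measure R) V I g mV mI mg (fun z _ => g0 z)).
Qed.

Lemma integral_chart_box_fin : (\int[mu]_(q in chart_box) (h q)%:E < +oo)%E.
Proof.
(* The bound is taken over the compact set [B * I], since [V] is merely measurable. *)
have [M hM] : exists M, forall z, (B `*` I) z -> h (layer_chart phi z) * w z <= M.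
  have : compact ((fun z => h (layer_chart phi z) * w z) @` (B `*` I)).
    apply: continuous_compact; last by apply: compact_setX => //; exact: segment_compact.
    apply: continuous_in_subspaceT => z /set_mem[/BU Uz _].
    by apply: cvgM; [exact: ch|exact: cw].
  move=> /compact_bounded[M [_ hM]]; exists (M + 1) => z Pz.
  apply: le_trans (ler_norm _) _; apply: (hM (M + 1)); first by rewrite ltrDl.
  by exists z.
rewrite integral_chart_box.
apply: (@le_lt_trans _ _ (\int[(lebesgue_measure \x lebesgue_measure)
    \x lebesgue_measure]_(z in V `*` I) (cst `|M|%:E) z)%E).
  apply: ge0_le_integral_nonmeasurable => z //.
  move=> [[Bz _] Iz]; rewrite lee_fin; apply: le_trans (hM _ _) (ler_norm _).
  by split.
rewrite integral_cst//; apply: lte_mul_pinfty => //.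
have := @product_measure1E _ _ _ _ R
  (@lebesgue_measure R \x @lebesgue_measure R)%E (@lebesgue_measure R) _ _ mV mI.
move=> /= ->.
have V_fin : ((lebesgue_measure \x lebesgue_measure)%E V < +oo)%E.
  apply: le_lt_trans (compact_measure2_finite cB).
  have sV : V `<=` B by move=> u [].
  by apply: le_measure; [rewrite inE|rewrite inE|exact: sV].
have I_fin : (lebesgue_measure I < +oo)%E.
  by apply: compact_finite_measure; exact: segment_compact.
by apply: lte_mul_pinfty => //; rewrite ge0_fin_numE.
Qed.

End functions.

End chart_box.

(** * Integral inequalities with a nearly constant weight *)

Section weighted_comparison.
Local Open Scope ereal_scope.
Context d (T : measurableType d) (R : realType).
Variables (m : {measure set T -> \bar R}) (V : set T).
Hypothesis mV : measurable V.

Lemma ge0_le_integral_scale (c : R) (F G : T -> \bar R) : (0 <= c)%R ->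
  measurable_fun V F -> (forall x, V x -> 0 <= F x) ->
  (forall x, V x -> c%:E * F x <= G x) ->
  c%:E * \int[m]_(x in V) F x <= \int[m]_(x in V) G x.
Proof.
move=> c0 mF F0 FG; rewrite -ge0_integralZl_EFin//.
apply: ge0_le_integral_nonmeasurable => // x Vx.
by rewrite mule_ge0// ?lee_fin// F0.
Qed.

(** On a fiber, [s] is the surface density and does not depend on [t]. Replacing [w] by [s] costs a
    factor [1 + e] on the left and [1 - e] on the right, and [s] itself cancels. *)
Lemma weighted_integral_comparison (F G w : T -> R) (k s e : R) :
  (0 <= k)%R -> (0 <= s)%R -> (0 < e < 1)%R ->
  (forall x, 0 <= F x)%R -> (forall x, 0 <= G x)%R ->
  measurable_fun V F -> measurable_fun V G ->
  (forall x, V x -> (1 - e) * s <= w x <= (1 + e) * s)%R ->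
  k%:E * \int[m]_(x in V) (F x)%:E <= \int[m]_(x in V) (G x)%:E ->
  (k * ((1 - e) / (1 + e)))%:E * \int[m]_(x in V) (F x * w x)%:E <=
  \int[m]_(x in V) (G x * w x)%:E.
Proof.
move=> k0 s0 /andP[e0 e1] F0 G0 mF mG hw kFG.
have e1p : (0 < 1 + e)%R by rewrite addr_gt0.
have e1m : (0 <= 1 - e)%R by rewrite subr_ge0 ltW.
have r0 : (0 <= (1 - e) / (1 + e))%R by rewrite divr_ge0// ltW.
have up : \int[m]_(x in V) (F x * w x)%:E <=
    ((1 + e) * s)%:E * \int[m]_(x in V) (F x)%:E.
  rewrite -ge0_integralZl_EFin//; last 3 first.
  - by move=> x _; rewrite lee_fin.
  - exact/measurable_EFinP.
  - by rewrite mulr_ge0// ltW.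
  apply: ge0_le_integral_nonmeasurable => x Vx; have /andP[w1 w2] := hw x Vx.
    by rewrite lee_fin mulr_ge0// (le_trans _ w1)// mulr_ge0.
  by rewrite -EFinM lee_fin mulrC ler_wpM2r.
have down : ((1 - e) * s)%:E * \int[m]_(x in V) (G x)%:E <=
    \int[m]_(x in V) (G x * w x)%:E.
  apply: ge0_le_integral_scale.
  - by rewrite mulr_ge0.
  - exact/measurable_EFinP.
  - by move=> x _; rewrite lee_fin.
  - move=> x Vx; have /andP[w1 w2] := hw x Vx.
    by rewrite -EFinM lee_fin mulrC ler_wpM2l.
apply: le_trans down.
apply: le_trans (_ : _ <= ((1 - e) * s)%:E * (k%:E * \int[m]_(x in V) (F x)%:E)) _;
  last by rewrite lee_wpmul2l// lee_fin mulr_ge0.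
apply: le_trans (_ : _ <= (k * ((1 - e) / (1 + e)))%:E *
  (((1 + e) * s)%:E * \int[m]_(x in V) (F x)%:E)) _.
  by rewrite lee_wpmul2l// lee_fin mulr_ge0.
rewrite !muleA -!EFinM.
suff -> : (k * ((1 - e) / (1 + e)) * ((1 + e) * s) = (1 - e) * s * k)%R by [].
by field; rewrite gt_eqF.
Qed.

End weighted_comparison.

(** * From fibers to compact regions of the surface *)

Section layer_poincare.
Context {R : realType}.
Variables (S : set (R * R * R)) (N : R * R * R -> R * R * R) (a b d e : R).
Variables (mu : {measure set (R * R * R * R) -> \bar R}) (f : R * R * R * R -> R).
Hypotheses (hN : unit_normal_field S N) (hmu : layer_volume S N a mu).
Hypotheses (b0 : 0 < b) (ba : b < a) (d0 : 0 < d) (d1 : d < 1) (e0 : 0 <= e)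
  (ae : a * e <= d / 4).
Hypothesis hf : forall U phi, chart S U phi ->
  smooth_on [set z : R * R * R | U z.1 /\ - a < z.2 < a] (f \o layer_chart phi).
Hypothesis fb : forall x t, b <= `|t| -> f (x, t) = 0.
Hypothesis pinch : forall U phi, chart S U phi -> forall u, U u ->
  (forall t, f (phi u, t) = 0) \/ second_form_norm N phi u < e.

Let I : set R := `[- a, a]%classic.
Let c := (pi / (2 * a)) ^+ 2 * ((1 - d) / (1 + d)).
Let f2 q := f q ^+ 2.
Let t2 q := layer_dt f q ^+ 2.

Let a0 : 0 < a. Proof. exact: lt_trans ba. Qed.

Let c0 : 0 <= c.
Proof.
rewrite mulr_ge0 ?sqr_ge0// divr_ge0//; first by rewrite subr_ge0 ltW.
by rewrite addr_ge0// ltW.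
Qed.

Let cf2 U phi : chart S U phi -> forall z, U z.1 ->
  {for z, continuous (f2 \o layer_chart phi)}.
Proof.
move=> hc z Uz; have [h _] := layer_chart_function_continuous ba hf fb hc Uz.
by apply: cvgM; exact: h.
Qed.

Let ct2 U phi : chart S U phi -> forall z, U z.1 ->
  {for z, continuous (t2 \o layer_chart phi)}.
Proof.
move=> hc z Uz; have [_ h] := layer_chart_function_continuous ba hf fb hc Uz.
by apply: cvgM; exact: h.
Qed.

Let f20 q : 0 <= f2 q. Proof. exact: sqr_ge0. Qed.
Let t20 q : 0 <= t2 q. Proof. exact: sqr_ge0. Qed.

(** Tonelli reduces the claim to single fibers. Either [f] vanishes on the whole fiber, or the
    curvature is small there and the weighted Dirichlet inequality applies. *)
Lemma chart_box_poincare U phi B Y : chart S U phi -> compact B -> B `<=` U ->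
  measurable Y ->
  (c%:E * \int[mu]_(q in chart_box a phi B Y) (f2 q)%:E <=
   \int[mu]_(q in chart_box a phi B Y) (t2 q)%:E)%E.
Proof.
move=> hc cB BU mY.
have mV : measurable (B `&` phi @^-1` Y).
  exact: (measurable_chart_preimage hc cB BU mY).
have := integral_chart_box_fibers hN hmu hc cB BU mY (cf2 hc) f20 => ->.
have := integral_chart_box_fibers hN hmu hc cB BU mY (ct2 hc) t20 => ->.
apply: ge0_le_integral_scale => //.
- exact: (measurable_chart_box_fibers a hN hc cB BU mY (cf2 hc) f20).
- by move=> u _; apply: integral_ge0 => t _; rewrite lee_fin mulr_ge0// sqrtr_ge0.
move=> u [/BU Uu _].
have [f0|Be] := pinch hc Uu.
  rewrite integral0_eq ?mule0.
    by apply: integral_ge0 => t _; rewrite lee_fin mulr_ge0// sqrtr_ge0.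
  by move=> t _; rewrite /f2 /layer_chart/= f0 expr0n mul0r.
have section_m (h : R * R * R * R -> R) :
    (forall z, U z.1 -> {for z, continuous (h \o layer_chart phi)}) ->
    measurable_fun I (fun t => h (phi u, t)).
  move=> ch; apply: (continuous_on_measurable_fun (@open_measurable R)).
    exact: measurable_itv.
  by move=> t _; have h' := continuous_section (ch (u, t) Uu); exact: h'.
apply: (@weighted_integral_comparison _ _ R lebesgue_measure I _
  (fun t => f2 (phi u, t)) (fun t => t2 (phi u, t))
  (fun t => Num.sqrt (\det (layer_metric N phi (u, t)))) _
  (surface_density phi u)) => //.
- exact: measurable_itv.
- exact: sqr_ge0.
- exact/ltW/(surface_density_gt0 hc).
- by rewrite d0.
- exact: section_m (cf2 hc).
- exact: section_m (ct2 hc).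
- move=> t; rewrite /I/= in_itv/= -ler_norml => ta.
  exact: (@layer_density_pinch _ _ _ _ _ hc hN a e d (u, t)).
- exact: (layer_fiber_poincare b0 ba hf fb hc).
Qed.

(** The quantification over [Y] makes the notion stable under unions: above [Y], [X1] contributes
    [X1 & Y] and [X2] contributes the disjoint rest, [X2] inside [Y] minus [X1]. Finiteness is kept
    for the later division by the integral of [f2]. *)
Definition good_region (X : set (R * R * R)) : Prop :=
  [/\ X `<=` S, measurable X,
      measurable_fun (X `*` I) f2, measurable_fun (X `*` I) t2 &
      forall Y, measurable Y ->
        (c%:E * \int[mu]_(q in (X `&` Y) `*` I) (f2 q)%:E <=
         \int[mu]_(q in (X `&` Y) `*` I) (t2 q)%:E)%E /\
        (\int[mu]_(q in (X `&` Y) `*` I) (f2 q)%:E < +oo)%E].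

Lemma good_region0 : good_region set0.
Proof.
split=> //.
- by rewrite set0X; exact: measurable_fun_set0.
- by rewrite set0X; exact: measurable_fun_set0.
- by move=> Y mY; rewrite set0I set0X !integral_set0 mule0.
Qed.

Lemma good_regionU X1 X2 : good_region X1 -> good_region X2 ->
  good_region (X1 `|` X2).
Proof.
move=> [S1 m1 f1 t1 h1] [S2 m2 f2' t2' h2].
have mI : measurable I by exact: measurable_itv.
have UX : (X1 `|` X2) `*` I = (X1 `*` I) `|` (X2 `*` I).
  by apply/seteqP; split=> -[x t] /=; [move=> [[?|?] ?]; [left|right]|move=> [[? ?]|[? ?]]; split=> //; [left|right]].
have mU (h : R * R * R * R -> R) : measurable_fun (X1 `*` I) h ->
    measurable_fun (X2 `*` I) h -> measurable_fun ((X1 `|` X2) `*` I) h.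
  by move=> ? ?; rewrite UX; apply/measurable_funU; [exact: measurableX|exact: measurableX|].
split.
- by move=> x [/S1|/S2].
- exact: measurableU.
- exact: mU.
- exact: mU.
move=> Y mY.
have mD : measurable (Y `\` X1) by exact: measurableD.
have [ineq1 fin1] := h1 Y mY; have [ineq2 fin2] := h2 _ mD.
have split_set : ((X1 `|` X2) `&` Y) `*` I =
    ((X1 `&` Y) `*` I) `|` ((X2 `&` (Y `\` X1)) `*` I).
  apply/seteqP; split=> -[x t] /=.
    move=> [[X12 Yx] It]; have [X1x|X1x] := pselect (X1 x); first by left.
    by right; case: X12.
  by move=> [[[? ?] ?]|[[? [? ?]] ?]]; split=> //; split=> //; [left|right].
have mA : measurable ((X1 `&` Y) `*` I) by apply: measurableX => //; exact: measurableI.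
have mB : measurable ((X2 `&` (Y `\` X1)) `*` I).
  by apply: measurableX => //; exact: measurableI.
have add (h : R * R * R * R -> R) : (forall q, 0 <= h q) ->
    measurable_fun ((X1 `|` X2) `*` I) h ->
    (\int[mu]_(q in ((X1 `|` X2) `&` Y) `*` I) (h q)%:E =
     \int[mu]_(q in (X1 `&` Y) `*` I) (h q)%:E +
     \int[mu]_(q in (X2 `&` (Y `\` X1)) `*` I) (h q)%:E)%E.
  move=> h0 mh; rewrite split_set ge0_integral_setU//.
  - apply/measurable_EFinP; apply: measurable_funS mh; rewrite ?UX.
      by apply: measurableU; exact: measurableX.
    by rewrite -split_set -UX => -[x t] [[? _] ?].
  - by move=> q _; rewrite lee_fin.
  - apply/disj_setPS => -[x t] [[[X1x _] _] [[_ [_ nX1]] _]]; exact: nX1.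
rewrite (add f2)//; last exact: mU.
rewrite (add t2)//; last exact: mU.
have pos D : (0 <= \int[mu]_(q in D) (f2 q)%:E)%E.
  by apply: integral_ge0 => q _; rewrite lee_fin.
split; last exact: lte_add_pinfty.
by rewrite ge0_muleDr//; exact: leeD.
Qed.

Lemma good_region_chart U phi B : chart S U phi -> compact B -> B `<=` U ->
  good_region (phi @` B).
Proof.
move=> hc cB BU.
have boxT : (phi @` B) `*` I = chart_box a phi B setT.
  by rewrite /chart_box setIT.
split.
- by move=> _ [u /BU Uu <-]; exact: (chart_sub hc).
- exact: (measurable_chart_image hc cB BU).
- by rewrite boxT; exact: (measurable_fun_chart_box hc cB BU (cf2 hc)).
- by rewrite boxT; exact: (measurable_fun_chart_box hc cB BU (ct2 hc)).
move=> Y mY; split; first exact: (chart_box_poincare hc cB BU mY).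
exact: (integral_chart_box_fin hN hmu hc cB BU mY (cf2 hc) f20).
Qed.

Hypothesis hS : embedded_surface S.

(** Each point of [Z] has a closed ball of parameters inside a chart: the closed ball is compact,
    hence its image is good, and the open ball inside it has a relatively open image. Finitely many
    of these cover [Z]. *)
Lemma compact_good_region (Z : set (R * R * R)) : compact Z -> Z `<=` S ->
  exists2 X, good_region X & Z `<=` X.
Proof.
move=> cZ ZS.
(* Stated for all [x], with a dummy pair outside [Z], so that [choice] yields a total function. *)
have loc x : exists p : set (R * R * R) * set (R * R * R),
    Z x -> [/\ open p.1, p.1 x, Z `&` p.1 `<=` p.2 & good_region p.2].
  have [Zx|nZ] := pselect (Z x); last by exists (set0, set0).
  have [U [phi [hc [u Uu ux]]]] := hS (ZS _ Zx).
  have [r /= r0 rU] : exists2 r : R, 0 < r & closed_ball u r `<=` U.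
    have : nbhs u U by exact: open_nbhs_nbhs (conj (chart_open hc) Uu).
    by move=> /nbhs_closedballP[r rU]; exists r%:num.
  have cB : compact (closed_ball u r : set (R * R)).
    exact: compact_closed_ball2.
  have [W' oW' eW] : exists2 W' : set (R * R * R), open W' &
      phi @` (U `&` ball u r) = S `&` W'.
    by case: hc => _ _ _ _; apply; exact: ball_open.
  exists (W', phi @` closed_ball u r) => _; split=> //=.
  - have : (phi @` (U `&` ball u r)) x by exists u => //; split=> //; exact: ballxx.
    by rewrite eW => -[].
  - move=> y [Zy Wy]; have : (S `&` W') y by split=> //; exact: ZS.
    rewrite -eW => -[v [Uv bv] <-]; exists v => //.
    exact: subset_closed_ball.
  - exact: (good_region_chart hc cB rU).
have [p hp] := choice loc.
move: cZ; rewrite compact_cover => /(_ _ Z (fun x => (p x).1)).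
case.
- by move=> x /hp[].
- by move=> x Zx; exists x => //; have [] := hp x Zx.
move=> D DZ Zcov; exists (\big[setU/set0]_(x <- finmap.enum_fset D) (p x).2).
  rewrite big_seq; apply: (big_ind good_region).
  - exact: good_region0.
  - exact: good_regionU.
  - by move=> x /DZ/set_mem/hp[].
rewrite -bigcup_fset => z Zz; have [x xD xz] := Zcov z Zz.
exists x => //; have [_ _ sub _] := hp x (set_mem (DZ _ xD)).
by apply: sub.
Qed.

End layer_poincare.

(** * Lower bounds for Rayleigh quotients *)

(** By continuity, the integrand in coordinates exceeds half its value at [z0] on a small cube,
    which has positive volume. *)
Lemma chart_box_integral_gt0 (R : realType) (S : set (R * R * R))
    (N : R * R * R -> R * R * R) (a : R)
    (mu : {measure set (R * R * R * R) -> \bar R})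
    (U : set (R * R)) (phi : R * R -> R * R * R) (h : R * R * R * R -> R)
    (z0 : R * R * R) :
  unit_normal_field S N -> layer_volume S N a mu -> chart S U phi ->
  (forall z, U z.1 -> {for z, continuous (h \o layer_chart phi)}) ->
  (forall q, 0 <= h q) -> U z0.1 -> - a < z0.2 < a ->
  0 < h (layer_chart phi z0) -> 0 < \det (layer_metric N phi z0) ->
  exists2 B, compact B /\ B `<=` U &
    (0 < \int[mu]_(q in chart_box a phi B setT) (h q)%:E)%E.
Proof.
move=> hN hmu hc ch h0 Uz /andP[az za] hz wz.
pose g z := h (layer_chart phi z) * Num.sqrt (\det (layer_metric N phi z)).
have g00 : 0 < g z0 by rewrite mulr_gt0// sqrtr_gt0.
have cg : {for z0, continuous g}.
  have h1 := ch z0 Uz; have h2 := continuous_det_layer_metric hc hN Uz.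
  by apply: cvgM; [exact: h1|apply: (continuous_comp h2); exact: sqrt_continuous].
have [r r0 hr] : exists2 r : R, 0 < r & forall z, ball z0 r z ->
    [/\ U z.1, - a < z.2 < a & g z0 / 2 < g z].
  have n1 : \forall z \near z0, g z0 / 2 < g z.
    apply: (cg [set y | g z0 / 2 < y]); apply: lt_nbhsr.
    by rewrite ltr_pdivrMr// mulr2n mulrDr mulr1 ltrDl.
  have n2 : \forall z \near z0, U z.1.
    have c1 : (fst : R * R * R -> R * R) @ z0 --> z0.1 by exact: cvg_fst.
    exact: (c1 _ (open_nbhs_nbhs (conj (chart_open hc) Uz))).
  have n3 : \forall z \near z0, - a < z.2 < a.
    have c2 : (snd : R * R * R -> R) @ z0 --> z0.2 by exact: cvg_snd.
    have o : nbhs z0.2 [set t : R | - a < t < a].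
      have : nbhs z0.2 (`]- a, a[%classic : set R).
        by apply: near_in_itvoo; rewrite in_itv/= az za.
      by apply: filterS => t /=; rewrite in_itv.
    exact: (c2 _ o).
  have : \forall z \near z0, [/\ U z.1, - a < z.2 < a & g z0 / 2 < g z].
    by apply: filterS (filterI (filterI n1 n2) n3) => z [[? ?] ?].
  by move=> /nbhs_ballP[r /= r0 hr]; exists r.
(* Half-width [r / 2] keeps the closed cube inside the open ball of radius [r] for the sup norm, and
   makes each side have length [r]. *)
pose J (x : R) : set R := `[x - r / 2, x + r / 2]%classic.
have mJ x : measurable (J x) by exact: measurable_itv.
have J0 x : (lebesgue_measure (J x) = r%:E)%E.
  rewrite /J lebesgue_measure_itv/= lte_fin ifT; last by lra.
  by rewrite -EFinB; congr EFin; field.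
have Jball x y : J x y -> ball x r y.
  rewrite /J /ball/= in_itv/= => /andP[y1 y2]; rewrite ltr_norml; lra.
pose B := J z0.1.1 `*` J z0.1.2.
have cB : compact B by apply: compact_setX; exact: segment_compact.
have Q z : (B `*` J z0.2) z -> [/\ U z.1, - a < z.2 < a & g z0 / 2 < g z].
  by move=> [[/= z11 z12] z2]; apply: hr; split; [split|]; exact: Jball.
have BU : B `<=` U.
  move=> u Bu; have [] := Q (u, z0.2) => //; split=> //.
  by rewrite /J/= in_itv/=; lra.
exists B => //.
rewrite (integral_chart_box hN hmu hc cB BU measurableT ch h0).
set lhs := (X in (_ < X)%E).
apply: (@lt_le_trans _ _ ((g z0 / 2)%:E *
  ((lebesgue_measure \x lebesgue_measure) \x lebesgue_measure) (B `*` J z0.2))%E).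
  have mB : measurable B by exact: measurableX.
  have := @product_measure1E _ _ _ _ R
    (@lebesgue_measure R \x @lebesgue_measure R)%E (@lebesgue_measure R)
    _ _ mB (mJ z0.2) => /= ->.
  have := @product_measure1E _ _ _ _ R (@lebesgue_measure R) (@lebesgue_measure R)
    _ _ (mJ z0.1.1) (mJ z0.1.2) => /= ->.
  rewrite !J0 -!EFinM lte_fin mulr_gt0//; first exact: divr_gt0.
  by rewrite !mulr_gt0.
have mBJ : measurable (B `*` J z0.2).
  by apply: measurableX => //; exact: measurableX.
rewrite -integral_cst// /lhs.
apply: ge0_le_integral_subset.
- move=> z zB; have [_ /andP[? ?] _] := Q z zB; split; first by case: zB.
  by rewrite /= in_itv/= !ltW.
- by move=> z _; rewrite lee_fin ltW// divr_gt0.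
- by move=> z zB; have [_ _ gz] := Q z zB; rewrite lee_fin ltW.
- by move=> z _; rewrite lee_fin mulr_ge0// sqrtr_ge0.
Qed.

(** Invertibility of the metric is assumed only on [C]. Off the closed set [C] the function vanishes
    near [q], so both sides are zero whatever [invmx] returns. *)
Lemma grad_sq_ge (R : realType) (S : set (R * R * R)) (N : R * R * R -> R * R * R)
    (f : R * R * R * R -> R) (C : set (R * R * R * R)) (q : R * R * R * R) :
  embedded_surface S -> unit_normal_field S N -> compact C ->
  (forall p, f p != 0 -> C p) -> S q.1 ->
  (forall U phi z, chart S U phi -> U z.1 -> layer_chart phi z = q -> C q ->
     layer_metric N phi z \in unitmx) ->
  layer_dt f q ^+ 2 <= grad_sq S N f q.
Proof.
move=> hS hN cC fC Sq hG.
rewrite /grad_sq; set P := (X in xget _ X).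
(* A chart around [q] exists, so [xget] returns a genuine value and not its default; the chart it
   uses is arbitrary. *)
have Pex : exists r, P r.
  have [U [phi [hc [u Uu uq]]]] := hS _ Sq.
  exists (chart_grad_sq N phi f (u, q.2)); exists U, phi, (u, q.2); split=> //.
  by rewrite /layer_chart/= uq; case: (q).
have [U [phi [z [hc Uz zq ->]]]] := xgetPex 0 Pex.
have dtE : layer_dt f q = 'D_(e3 i2) (f \o layer_chart phi) z.
  by rewrite e3_2 derive_snd -zq.
have [Cq|nCq] := pselect (C q).
  by rewrite dtE; apply: (chart_grad_sq_ge hc hN) => //; exact: (hG U phi z hc Uz zq Cq).
have near0 : \forall y \near z, (f \o layer_chart phi) y = cst 0 y.
  have oC : open (~` C).
    by apply: closed_openC; apply: compact_closed => //; exact: norm_hausdorff.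
  have cl : {for z, continuous (layer_chart phi)}.
    have c1 := continuous_comp_fst (Y := R) (chart_continuous hc Uz).
    by apply: (continuous_pair c1); exact: cvg_snd.
  have nz : nbhs (layer_chart phi z) (~` C).
    by apply: open_nbhs_nbhs; split=> //; rewrite zq.
  have n2 : nbhs z (layer_chart phi @^-1` (~` C)) := cl _ nz.
  apply: filterS n2 => y nCy /=.
  by apply/eqP; apply: contrapT => /negP/fC.
have D0 v : 'D_v (f \o layer_chart phi) z = 0.
  by apply: (etrans (near_eq_derive v near0)); exact: derive_cst.
rewrite dtE D0 expr0n /chart_grad_sq /=.
suff -> : \row_i 'D_(e3 i) (f \o layer_chart phi) z = 0 by rewrite !mul0mx mxE.
by apply/rowP => i; rewrite !mxE D0.
Qed.

(** The supremum is tested on a single compact set. The margin [b] and the region [X] depend on the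
    test function, but the resulting constant does not. *)
Lemma sigma_ess_ge_pinched (R : realType) (S : set (R * R * R))
  (N : R * R * R -> R * R * R) (a d : R)
  (mu : {measure set (R * R * R * R) -> \bar R}) :
  embedded_surface S -> unit_normal_field S N ->
  second_form_vanishes_at_infinity S N -> 0 < a -> layer_volume S N a mu ->
  0 < d -> d < 1 ->
  (((pi / (2 * a)) ^+ 2 * ((1 - d) / (1 + d)))%:E <= sigma_ess S N a mu)%E.
Proof.
move=> hS hN hB a0 hmu d0 d1.
(* Chosen so that [a * e = d / 4], the threshold of the Jacobian estimate. *)
pose e := d / (4 * a).
have e0 : 0 < e by rewrite divr_gt0// mulr_gt0.
have ae : a * e <= d / 4.
  by rewrite le_eqVlt; apply/orP; left; apply/eqP; rewrite /e; field; rewrite gt_eqF.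
have [K' [cK' K'S hK']] := hB e e0.
pose I : set R := `[- a, a]%classic.
pose K := K' `*` I.
apply: (@le_trans _ _ (ereal_inf
  [set rayleigh S N a mu f | f in test_function S a K])); last first.
  apply: ereal_sup_ubound; exists K => //; split.
    by apply: compact_setX => //; exact: segment_compact.
  by move=> [x t] [/= /K'S Sx]; rewrite /I/= in_itv.
apply: le_ereal_inf_tmp => _ [f [hf [C [cC CK fC]] [q0 fq0]] <-].
have Cq0 := fC _ fq0.
(* The midpoint between [a] and the largest [|t|] on the support. *)
have [b [b0 ba bC]] : exists b, [/\ 0 < b, b < a & forall q, C q -> `|q.2| < b].
  have cn : {within C, continuous (fun q : R * R * R * R => `|q.2|)}.
    apply: continuous_subspaceT => q.
    apply: (@continuous_comp _ _ _ (snd : R * R * R * R -> R) (@Num.norm R R)).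
      exact: cvg_snd.
    exact: norm_continuous.
  have [q Cq hq] := @compact_EVT_max _ R _ C (ex_intro _ q0 Cq0) cC cn.
  have [[_ +] _] := CK _ (set_mem Cq); rewrite -ltr_norml => qa.
  exists ((`|q.2| + a) / 2); split.
  - by rewrite divr_gt0// ltr_wpDl.
  - by lra.
  - by move=> p Cp; have := hq p (mem_set Cp); lra.
have fb x t : b <= `|t| -> f (x, t) = 0.
  move=> bt; apply/eqP; apply: contraT => /fC/bC /=.
  by rewrite ltNge bt.
(* Above a point of [K'] the test function vanishes on the entire fiber, since its support avoids
   [K]. *)
have pinch U phi : chart S U phi -> forall u, U u ->
    (forall t, f (phi u, t) = 0) \/ second_form_norm N phi u < e.
  move=> hc u Uu; have [Ku|nKu] := pselect (K' (phi u)); last first.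
    by right; exact: (hK' _ _ hc).
  left=> t; apply/eqP; apply: contraT => /fC/CK[[_ /= /andP[t1 t2]] nK].
  by exfalso; apply: nK; split=> //; rewrite /I/= in_itv/= !ltW.
have cfst : compact (fst @` C).
  by apply: continuous_compact => //; apply: continuous_subspaceT => q; exact: cvg_fst.
have CS : fst @` C `<=` S by move=> _ [q /CK[[Sq _] _] <-].
have [X [XS mX mfX mtX hX] CX] := compact_good_region hN hmu b0 ba d0 d1 (ltW e0)
  ae hf fb pinch hS cfst CS.
have [] := hX setT measurableT; rewrite setIT -/I => ineq fin.
have detG U phi z : chart S U phi -> U z.1 -> C (layer_chart phi z) ->
    0 < \det (layer_metric N phi z).
  move=> hc Uz Cz; have [[_ /= zI] nK] := CK _ Cz.
  have Be : second_form_norm N phi z.1 < e.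
    apply: (hK' _ _ hc _ Uz) => Kz; apply: nK; split=> //=.
    by move: zI => /andP[z1 z2]; rewrite /I/= in_itv/= !ltW.
  have za : `|z.2| <= a by rewrite ltW// ltr_norml.
  have /andP[+ _] := layer_density_pinch hc hN a0 d0 d1 (ltW e0) ae Uz za Be.
  rewrite -sqrtr_gt0; apply: lt_le_trans; rewrite mulr_gt0 ?subr_gt0//.
  exact: (surface_density_gt0 hc).
have layerX : X `*` I `<=` layer S a.
  by move=> [x t] [/= /XS Sx]; rewrite /I/= in_itv.
have suppX q : layer S a q -> ~ (X `*` I) q -> f q = 0.
  move=> [Sq qa] nX; apply/eqP; apply: contraT => /fC Cq; exfalso; apply: nX.
  by split; [apply: CX; exists q|rewrite /I/= in_itv].
have den : (\int[mu]_(q in layer S a) (f q ^+ 2)%:E =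
    \int[mu]_(q in X `*` I) (f q ^+ 2)%:E)%E.
  by apply: integral_subset_support => // q Sq nX; rewrite suppX// expr0n.
have num : (\int[mu]_(q in X `*` I) (layer_dt f q ^+ 2)%:E <=
    \int[mu]_(q in layer S a) (grad_sq S N f q)%:E)%E.
  apply: (@le_trans _ _ (\int[mu]_(q in layer S a) (layer_dt f q ^+ 2)%:E)%E).
    by apply: ge0_le_integral_subset => // q _; rewrite lee_fin sqr_ge0.
  apply: ge0_le_integral_nonmeasurable => q [Sq qa]; rewrite lee_fin ?sqr_ge0//.
  apply: (grad_sq_ge hS hN cC fC Sq) => U phi z hc Uz zq Cq.
  by rewrite unitmxE unitfE gt_eqF// (detG U)// zq.
(* Positivity of the denominator, with its finiteness, turns the extended-real quotient into an
   ordinary division. *)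
have pos : (0 < \int[mu]_(q in layer S a) (f q ^+ 2)%:E)%E.
  have [[Sq0 qa] _] := CK _ Cq0.
  have [U [phi [hc [u Uu uq]]]] := hS _ Sq0.
  have lq : layer_chart phi (u, q0.2) = q0.
    by rewrite /layer_chart/= uq; case: (q0).
  have ch z : U z.1 -> {for z, continuous ((fun q => f q ^+ 2) \o layer_chart phi)}.
    move=> Uz; have [h _] := layer_chart_function_continuous ba hf fb hc Uz.
    by apply: cvgM; exact: h.
  have [||||B [cB BU]] := @chart_box_integral_gt0 _ _ _ _ mu _ _ _ (u, q0.2)
      hN hmu hc ch (fun q => sqr_ge0 (f q)) => //.
  - by rewrite lq lt_neqAle sqr_ge0 andbT eq_sym sqrf_eq0.
  - by apply: (detG U) => //; rewrite lq.
  move=> /lt_le_trans; apply.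
  apply: ge0_le_integral_subset => [s|s _|//|s _]; rewrite ?lee_fin ?sqr_ge0//.
  move=> [[[v Bv vs] _] Is]; split; last by move: Is; rewrite /= in_itv.
  by rewrite -vs; apply: (chart_sub hc); exact: BU.
rewrite /rayleigh; move: pos; rewrite den => pos.
have finE : (\int[mu]_(q in X `*` I) (f q ^+ 2)%:E)%E \is a fin_num.
  by rewrite ge0_fin_numE// ltW.
have := le_trans ineq num; rewrite -(fineK finE).
have : 0 < fine (\int[mu]_(q in X `*` I) (f q ^+ 2)%:E)%E.
  by rewrite fine_gt0// pos.
move: (fine _) => r r0 ineqr.
by rewrite inver gt_eqF// lee_pdivlMr.
Qed.

(** * The limit of a vanishing density distortion *)

Theorem lemma2p1 (R : realType) (S : set (R * R * R))
  (N : R * R * R -> R * R * R) (a : R)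
  (mu : {measure set (R * R * R * R) -> \bar R})
  (hS : embedded_surface S) (hor : orientable S) (hcomplete : complete_surface S)
  (hnc : ~ compact S) (hN : unit_normal_field S N)
  (hntg : ~ totally_geodesic S N)
  (hB : second_form_vanishes_at_infinity S N)
  (ha : 0 < a) (hemb : layer_embedding S N a)
  (hmu : layer_volume S N a mu) :
  ((pi ^+ 2 / (4 * a ^+ 2))%:E <= sigma_ess S N a mu)%E.
Proof.
set k := pi ^+ 2 / (4 * a ^+ 2).
have kE : k = (pi / (2 * a)) ^+ 2 by rewrite /k; field; rewrite gt_eqF.
have k0 : 0 < k by rewrite kE exprn_gt0// divr_gt0 ?pi_gt0// mulr_gt0.
apply/lee_addgt0Pr => e e0.
(* Since [(1 - d) / (1 + d) >= 1 - 2 d], the loss is at most [2 k d], which the second term keeps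
   below [e]; the first ensures [d < 1]. *)
pose d := Num.min (1 / 2) (e / (2 * k)).
have d0 : 0 < d by rewrite lt_min divr_gt0//= divr_gt0// mulr_gt0.
have d12 : d <= 1 / 2 by rewrite ge_min lexx.
have dk : k * (2 * d) <= e.
  have k20 : 0 < 2 * k by exact: mulr_gt0.
  rewrite mulrCA (mulrC k) mulrCA -ler_pdivlMr//.
  by rewrite ge_min lexx orbT.
have d1 : d < 1 by lra.
have := sigma_ess_ge_pinched hS hN hB ha hmu d0 d1; rewrite -kE => h.
apply: (@le_trans _ _ ((k * ((1 - d) / (1 + d)))%:E + e%:E)%E);
  last exact: leeD2r.
rewrite -EFinD lee_fin.
have h2 : 1 - 2 * d <= (1 - d) / (1 + d) by rewrite ler_pdivlMr; [nra|lra].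
have := ler_wpM2l (ltW k0) h2; rewrite mulrBr mulr1.
move: (k * ((1 - d) / (1 + d))) (k * (2 * d)) dk => x y dk; lra.
Qed.
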